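(* Let $\Omega$ be an eventually outward finitely branched tree quiver and $V$ a representation of $\Omega$ over a field. For each $\alpha\in\mathcal{C}$, if every arrow $e$ in $\alpha$ has exactly one virtual boundary arrow of $\Omega$ behind it, then $W^\alpha=F^\alpha/\sum_{\beta<\alpha}F^\beta$ is an isotypic representation of $\Omega$.
   Context: A quiver $\Omega$ consists of a set $\Omega_0$ of vertices, a set $\Omega_1$ of arrows, and source and target functions $s,t:\Omega_1\to\Omega_0$. It is a tree if its underlying undirected graph is a tree (at most one arrow between two vertices, no loops). A walk is a map $w$ from a finite or infinite interval of $\mathbb{Z}$ to $\Omega_0$ with consecutive values joined by an arrow $e$; $e$ is oriented consistently if $s(e)=w_i,\ t(e)=w_{i+1}$, inconsistently if $s(e)=w_{i+1},\ t(e)=w_i$. A journey is a walk whose interval has a minimal element. $\Omega$ is finitely branched if it is a union of finitely many injective walks, and eventually outward if every injective journey contains at most finitely many arrows oriented inconsistently. Removing an arrow $e$ splits $\Omega$ into two connected subquivers: the one containing $t(e)$ is in front of $e$, and the one containing $s(e)$ is behind $e$. Anything contained in the former (latter) is in front of (behind) $e$, and $e$ points towards (away from) it. $\mathcal{C}$ is the set of (nonempty) connected full subquivers of $\Omega$. A boundary arrow of $\alpha\in\mathcal{C}$ is an arrow with exactly one endpoint in $\alpha$; $\mathrm{iba}(\alpha)$ (resp. $\mathrm{oba}(\alpha)$) is the set of those pointing towards (resp. away from) $\alpha$. $\beta$ is a reduction of $\alpha$ if there is an arrow $e$ in $\alpha$ such that $\beta$ is the portion of $\alpha$ behind $e$;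 $\beta$ is an enhancement of $\alpha$ if there is an arrow $e$ in $\beta$ such that $\alpha$ is the portion of $\beta$ in front of $e$. Write $\alpha>\beta$ if $\beta$ is obtained from $\alpha$ by a finite sequence of one or more such moves. A representation $V$ consists of vector spaces $V_i$ ($i\in\Omega_0$) and linear maps $f_e:V_{s(e)}\to V_{t(e)}$ ($e\in\Omega_1$). The transport of a subspace of $V_i$ to a vertex $j$ follows the unique injective walk from $i$ to $j$, taking the image under $f_e$ when $e$ is crossed from $s(e)$ to $t(e)$ and the preimage under $f_e$ when $e$ is crossed from $t(e)$ to $s(e)$. For an arrow $e$: $V^{e,+}_i=V_i$ if $i$ is behind $e$, and otherwise the transport of $V_{t(e)}$ from $t(e)$ to $i$; $V^{e,-}_i=0$ if $i$ is in front of $e$, and otherwise the transport of $\{0\}\subseteq V_{t(e)}$ to $i$. These are subrepresentations of $V$. A virtual arrow $E$ is an injective journey with all arrows oriented away from its start, which is either infinite or ends in a leaf of $\Omega$ (possibly a single leaf vertex). $V^{E,+}_i=V_i$ if $i\in E$, and otherwise the transport to $i$ of $V_j$, with $j$ the vertex of $E$ closest to $i$. Virtual arrows that differ only in where they start (one is an end segment of the other) define the same subrepresentation and are counted as the same. If $E$ lies entirely in $\alpha$ it is a virtual boundary arrow of $\alpha$ (in particular every virtual arrow is a virtual boundary arrow of $\Omega$); $E$ is behind $e$ if, after possibly passing to an end segment, it lies in the subquiver behind $e$. For $\alpha\in\mathcal{C}$, $F^\alpha$ is the intersection of all $V^{e,+}$ for $e\in\mathrm{iba}(\alpha)$, all $V^{e,-}$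 for $e\in\mathrm{oba}(\alpha)$, and all $V^{E,+}$ for $E$ a virtual boundary arrow of $\alpha$. One has $F^\beta\subseteq F^\alpha$ for $\beta\le\alpha$. A representation is indecomposable if it is nonzero and is not a direct sum of two proper nonzero subrepresentations. A representation $W$ is isotypic if there are an indecomposable representation $X$, a vector space $Y$, and isomorphisms $W_i\cong X_i\otimes Y$ for every vertex $i$, under which each map $f^W_e$ corresponds to $f^X_e\otimes 1$. *)

(* Defs.v *)
From HB Require Import structures.
From mathcomp Require Import all_boot all_order all_algebra generic_quotient.
From mathcomp Require Import ring_quotient.
From mathcomp Require Import boolp classical_sets cardinality.
From mathcomp Require Import freeg.
From Stdlib Require Import Relation_Operators.

Set Implicit Arguments.
Unset Strict Implicit.
Unset Printing Implicit Defensive.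

Import Order.TTheory GRing.Theory Num.Theory.

Local Open Scope classical_set_scope.
Local Open Scope ring_scope.
Local Open Scope quotient_scope.

Section Subspaces.
Variables (K : fieldType) (V : lmodType K).

Definition is_subspace (A : set V) : Prop :=
  A 0 /\ forall a u v, A u -> A v -> A (a *: u + v).

Definition subspace_pred (A : set V) (hA : is_subspace A) : {pred V} :=
  fun x => `[< A x >].

Lemma subspace_pred_closed A (hA : is_subspace A) :
  submod_closed (subspace_pred hA).
Proof.
case: (hA) => A0 AD; split; first exact/asboolP.
by move=> a u v /asboolP Au /asboolP Av; apply/asboolP/AD.
Qed.

HB.instance Definition _ A (hA : is_subspace A) :=
  GRing.isSubmodClosed.Build K V (subspace_pred hA) (subspace_pred_closed hA).

Definition subspace_of A (hA : is_subspace A) : submodClosed V :=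
  subspace_pred hA.

Lemma subspace_ofE A (hA : is_subspace A) x : (x \in subspace_of hA) <-> A x.
Proof. by split=> [/asboolP|Ax]; [|apply/asboolP]. Qed.

Lemma submod_subspace (A : submodClosed V) : is_subspace (fun x => x \in A).
Proof. by split=> [|a u v Au Av]; rewrite ?rpred0 // rpredD ?rpredZ. Qed.

Definition lspan (S : set V) : set V :=
  [set x | exists2 s : seq (K * V),
     forall c, c \in s -> S c.2 & x = \sum_(c <- s) c.1 *: c.2].

Lemma lspan_subspace S : is_subspace (lspan S).
Proof.
split; first by exists [::] => //; rewrite big_nil.
move=> a u v [s Ss ->] [t St ->].
exists ([seq (a * c.1, c.2) | c <- s] ++ t).
  by move=> c; rewrite mem_cat => /orP[/mapP[d /Ss Sd ->]//|/St].
rewrite big_cat big_map /= scaler_sumr; congr (_ + _).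
by apply: eq_bigr => c _; rewrite scalerA.
Qed.

Lemma sub_lspan S x : S x -> lspan S x.
Proof.
move=> Sx; exists [:: (1, x)]; last by rewrite big_seq1 scale1r.
by move=> c; rewrite inE => /eqP ->.
Qed.

Lemma lspan_min S (A : submodClosed V) :
  (forall x, S x -> x \in A) -> forall x, lspan S x -> x \in A.
Proof.
move=> SA _ [s Ss ->]; rewrite big_seq; apply: rpred_sum => c cs.
by apply: rpredZ; apply/SA/Ss.
Qed.

Definition subsp (A : submodClosed V) := {x : V | x \in A}.

HB.instance Definition _ (A : submodClosed V) := Choice.on (subsp A).
HB.instance Definition _ (A : submodClosed V) := SubType.on (subsp A).
HB.instance Definition _ (A : submodClosed V) :=
  [SubChoice_isSubLmodule of subsp A by <:].

Definition zmod_of_submod (A : submodClosed V) : zmodClosed V :=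
  HB.pack (A : {pred V}) (GRing.isZmodClosed.Build V (A : {pred V})
    (GRing.submod_closedB (submodClosedP A))).

Definition quotsp (A : submodClosed V) := Quotient.quot (zmod_of_submod A).

HB.instance Definition _ (A : submodClosed V) := GRing.Zmodule.on (quotsp A).

Section QuotientSpace.
Variable A : submodClosed V.

Definition quotsp_pi (x : V) : quotsp A := \pi_(Quotient.quot (zmod_of_submod A)) x.

Lemma quotsp_eq x y : (quotsp_pi x = quotsp_pi y) <-> (x - y \in A).
Proof.
rewrite (Quotient.idealrBE (zmod_of_submod A) x y).
by split=> [xy|/eqP//]; apply/eqP.
Qed.

Lemma quotsp_pi_surj (q : quotsp A) : exists x, q = quotsp_pi x.
Proof. by exists (repr q); rewrite /quotsp_pi reprK. Qed.

Lemma quotsp_piD x y : quotsp_pi (x + y) = quotsp_pi x + quotsp_pi y.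
Proof. exact: raddfD. Qed.

Definition quotsp_scale (a : K) (q : quotsp A) : quotsp A :=
  quotsp_pi (a *: repr q).

Lemma quotsp_scaleE a x : quotsp_scale a (quotsp_pi x) = quotsp_pi (a *: x).
Proof.
apply/quotsp_eq; rewrite -scalerBr; apply: rpredZ.
by apply/quotsp_eq; rewrite /quotsp_pi reprK.
Qed.

Fact quotsp_scaleA a b q :
  quotsp_scale a (quotsp_scale b q) = quotsp_scale (a * b) q.
Proof. by have [x ->] := quotsp_pi_surj q; rewrite !quotsp_scaleE scalerA. Qed.

Fact quotsp_scale1 : left_id 1 quotsp_scale.
Proof.
by move=> q; have [x ->] := quotsp_pi_surj q; rewrite quotsp_scaleE scale1r.
Qed.

Fact quotsp_scaleDr : right_distributive quotsp_scale +%R.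
Proof.
move=> a q r; have [x ->] := quotsp_pi_surj q; have [y ->] := quotsp_pi_surj r.
by rewrite -quotsp_piD !quotsp_scaleE -quotsp_piD scalerDr.
Qed.

Fact quotsp_scaleDl q :
  {morph quotsp_scale^~ q : a b / a + b}.
Proof.
move=> a b /=; have [x ->] := quotsp_pi_surj q.
by rewrite !quotsp_scaleE -quotsp_piD scalerDl.
Qed.

HB.instance Definition _ := GRing.Zmodule_isLmodule.Build K (quotsp A)
  quotsp_scaleA quotsp_scale1 quotsp_scaleDr quotsp_scaleDl.

Fact quotsp_pi_linear : linear quotsp_pi.
Proof. by move=> a x y; rewrite quotsp_piD -quotsp_scaleE. Qed.

HB.instance Definition _ :=
  GRing.isLinear.Build K V (quotsp A) *:%R quotsp_pi quotsp_pi_linear.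

End QuotientSpace.
End Subspaces.

Section InducedMaps.
Variables (K : fieldType) (U V : lmodType K) (f : {linear U -> V}).
Variables (A : submodClosed U) (B : submodClosed V).
Hypothesis fAB : forall x, x \in A -> f x \in B.

Definition sub_map_fun (x : subsp A) : subsp B :=
  exist _ (f (val x)) (fAB (valP x)).

Fact sub_map_linear : linear sub_map_fun.
Proof. by move=> a x y; apply/val_inj; rewrite /= linearP. Qed.

HB.instance Definition _ :=
  GRing.isLinear.Build K (subsp A) (subsp B) *:%R sub_map_fun sub_map_linear.

Definition sub_map : {linear subsp A -> subsp B} := sub_map_fun.

Definition quot_map_fun (q : quotsp A) : quotsp B := quotsp_pi B (f (repr q)).

Lemma quot_map_funE x : quot_map_fun (quotsp_pi A x) = quotsp_pi B (f x).
Proof.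
apply/quotsp_eq; rewrite -linearB; apply: fAB.
by apply/quotsp_eq; rewrite /quotsp_pi reprK.
Qed.

Fact quot_map_linear : linear quot_map_fun.
Proof.
move=> a q r; have [x ->] := quotsp_pi_surj q; have [y ->] := quotsp_pi_surj r.
by rewrite -linearP !quot_map_funE !linearP.
Qed.

HB.instance Definition _ :=
  GRing.isLinear.Build K (quotsp A) (quotsp B) *:%R quot_map_fun quot_map_linear.

Definition quot_map : {linear quotsp A -> quotsp B} := quot_map_fun.

End InducedMaps.

Section Tensor.
Variable K : fieldType.

Lemma fglift_linear (T : choiceType) (M : lmodType K) (f : T -> M) :
  linear (fglift f).
Proof.
have liftD := lift_is_additive f.
pose L : {additive {freeg T / K} -> M} :=
  HB.pack (fglift f) (GRing.isZmodMorphism.Build _ _ _ liftD).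
have LE D : fglift f D = L D by [].
move=> a D E; rewrite !LE raddfD; congr (_ + _).
have -> : a *: D = \sum_(x <- dom D) << a * coeff x D *g x >> by [].
rewrite -[X in _ = _ *: L X]freeg_sumE !(raddf_sum L) scaler_sumr.
by apply: eq_bigr => x _; rewrite -!LE !liftU scalerA.
Qed.

Definition free_map_fun (T T' : choiceType) (g : T -> T') :
  {freeg T / K} -> {freeg T' / K} := fglift (fun t => << g t >>).

HB.instance Definition _ (T T' : choiceType) (g : T -> T') :=
  GRing.isLinear.Build K {freeg T / K} {freeg T' / K} *:%R (free_map_fun g)
    (fglift_linear _).

Definition free_map (T T' : choiceType) (g : T -> T') :
  {linear {freeg T / K} -> {freeg T' / K}} := free_map_fun g.

Lemma free_mapE (T T' : choiceType) (g : T -> T') t : free_map g << t >> = << g t >>.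
Proof. by rewrite /free_map /= /free_map_fun liftU scale1r. Qed.

Definition tensor_rel (X Y : lmodType K) : set {freeg (X * Y)%type / K} :=
  [set z |
     [\/ exists x x' y, z = << (x + x', y) >> - << (x, y) >> - << (x', y) >>,
         exists x y y', z = << (x, y + y') >> - << (x, y) >> - << (x, y') >>,
         exists a x y, z = << (a *: x, y) >> - a *: << (x, y) >> |
         exists a x y, z = << (x, a *: y) >> - a *: << (x, y) >>]].

Definition tensor_ker (X Y : lmodType K) : submodClosed {freeg (X * Y)%type / K} :=
  subspace_of (lspan_subspace (@tensor_rel X Y)).

Definition tensor (X Y : lmodType K) : lmodType K := quotsp (tensor_ker X Y).

Definition pure (X Y : lmodType K) (x : X) (y : Y) : tensor X Y :=
  quotsp_pi (tensor_ker X Y) << (x, y) >>.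

Section TensorMap.
Variables (X X' Y : lmodType K) (f : {linear X -> X'}).

Lemma tensor_ker_map z : z \in tensor_ker X Y ->
  free_map (fun p : X * Y => (f p.1, p.2)) z \in tensor_ker X' Y.
Proof.
set g := free_map _ => /subspace_ofE [s hs ->]; rewrite linear_sum big_seq.
apply: rpred_sum => c cs; rewrite linearZ; apply: rpredZ.
apply/subspace_ofE/sub_lspan.
case: (hs _ cs) => -[a [b [d ->]]].
- rewrite !linearB /= !free_mapE /= linearD.
  by apply: Or41; exists (f a), (f b), d.
- rewrite !linearB /= !free_mapE /=.
  by apply: Or42; exists (f a), b, d.
- rewrite linearB linearZ /= !free_mapE /= linearZ.
  by apply: Or43; exists a, (f b), d.
- rewrite linearB linearZ /= !free_mapE /=.
  by apply: Or44; exists a, (f b), d.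
Qed.

Definition tensor_map : {linear tensor X Y -> tensor X' Y} :=
  quot_map tensor_ker_map.

Lemma tensor_mapE x y : tensor_map (pure x y) = pure (f x) y.
Proof. apply: (etrans (quot_map_funE tensor_ker_map _)).
by rewrite free_mapE. Qed.

End TensorMap.
End Tensor.

Record quiver := Quiver {
  vertex :> choiceType;
  arrow : choiceType;
  src : arrow -> vertex;
  tgt : arrow -> vertex }.

Section Quivers.
Variable Q : quiver.
Implicit Types (i j k : Q) (e a : arrow Q) (al be : set Q).

Definition joins e i j : Prop :=
  (src e = i /\ tgt e = j) \/ (src e = j /\ tgt e = i).

(* The values of a walk outside of its domain are irrelevant. *)
Record walk := Walk {
  wdom : interval int;
  wpt :> int -> Q;
  walk_adj : forall n, n \in wdom -> n + 1 \in wdom ->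
    exists e, joins e (wpt n) (wpt (n + 1)) }.

Definition wvertices (w : walk) : set Q := [set w n | n in [set` wdom w]].

Definition injective_walk (w : walk) : Prop := {in wdom w &, injective w}.

Definition is_first (w : walk) (m : int) : Prop :=
  m \in wdom w /\ forall n, n \in wdom w -> m <= n.

Definition is_last (w : walk) (m : int) : Prop :=
  m \in wdom w /\ forall n, n \in wdom w -> n <= m.

Definition is_journey (w : walk) : Prop := exists m, is_first w m.

Definition consistent (w : walk) e : Prop :=
  exists n, [/\ n \in wdom w, n + 1 \in wdom w, src e = w n & tgt e = w (n + 1)].

Definition inconsistent (w : walk) e : Prop :=
  exists n, [/\ n \in wdom w, n + 1 \in wdom w, src e = w (n + 1) & tgt e = w n].

Definition eventually_outward : Prop :=
  forall w, is_journey w -> injective_walk w ->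
    finite_set [set e | inconsistent w e].

Definition finitely_branched : Prop :=
  exists (n : nat) (w : 'I_n -> walk),
    [/\ forall m, injective_walk (w m),
        forall i, exists m, wvertices (w m) i
      & forall e, exists m, consistent (w m) e \/ inconsistent (w m) e].

(* A finite walk together with the arrow crossed at each step, as needed to
   transport subspaces along it. *)
Inductive route i : Q -> Type :=
| Rnil : route i i
| Rfwd e of route i (src e) : route i (tgt e)
| Rbwd e of route i (tgt e) : route i (src e).

Fixpoint rverts i j (p : route i j) : seq Q :=
  match p with
  | Rnil => [:: i]
  | Rfwd e q => rcons (rverts q) (tgt e)
  | Rbwd e q => rcons (rverts q) (src e)
  end.

Fixpoint rarrows i j (p : route i j) : seq (arrow Q) :=
  match p with
  | Rnil => [::]
  | Rfwd e q | Rbwd e q => rcons (rarrows q) e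
  end.

Definition rlength i j (p : route i j) : nat := size (rarrows p).

Definition injective_route i j (p : route i j) : bool := uniq (rverts p).

Record is_tree : Prop := IsTree {
  tree_loopless : forall e, src e <> tgt e;
  tree_simple : forall e e', joins e' (src e) (tgt e) -> e = e';
  tree_connected : forall i j, inhabited (route i j);
  tree_acyclic : forall i (p : route i i),
    (2 < rlength p)%N -> ~~ uniq (behead (rverts p)) }.

Definition in_front e : set Q :=
  [set i | exists p : route (tgt e) i, e \notin rarrows p].

Definition behind e : set Q :=
  [set i | exists p : route (src e) i, e \notin rarrows p].

(* Here and below a full subquiver is identified with its set of vertices. *)
Definition connected_subquiver al : Prop :=
  al !=set0 /\ forall i j, al i -> al j ->
    exists p : route i j, [set` rverts p] `<=` al.

Definition arrow_in al e : Prop := al (src e) /\ al (tgt e).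

Definition boundary_arrow al e : Prop :=
  (al (src e) /\ ~ al (tgt e)) \/ (~ al (src e) /\ al (tgt e)).

Definition iba al : set (arrow Q) :=
  [set e | boundary_arrow al e /\ al `<=` in_front e].

Definition oba al : set (arrow Q) :=
  [set e | boundary_arrow al e /\ al `<=` behind e].

Definition is_reduction al be : Prop :=
  exists2 e, arrow_in al e & be = al `&` behind e.

Definition is_enhancement al be : Prop :=
  exists2 e, arrow_in be e & al = be `&` in_front e.

Definition move al be : Prop :=
  connected_subquiver be /\ (is_reduction al be \/ is_enhancement al be).

Definition sub_gt : set Q -> set Q -> Prop := clos_trans _ move.

Definition leaf i : Prop := exists! e, src e = i \/ tgt e = i.

Record virtual_arrow (E : walk) : Prop := VirtualArrow {
  va_journey : is_journey E;
  va_injective : injective_walk E;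
  va_outward : forall n, n \in wdom E -> n + 1 \in wdom E ->
    exists e, src e = E n /\ tgt e = E (n + 1);
  va_end : infinite_set [set` wdom E] \/ exists2 m, is_last E m & leaf (E m) }.

Definition end_segment (E E' : walk) : Prop :=
  exists c : int,
    (exists2 m, m \in wdom E &
       forall n, (n \in wdom E') = (m <= n + c) && (n + c \in wdom E))
    /\ forall n, n \in wdom E' -> E' n = E (n + c).

(* The equivalence relation generated by [end_segment] on virtual arrows. *)
Definition same_virtual_arrow (E E' : walk) : Prop :=
  exists2 E0, end_segment E E0 & end_segment E' E0.

Definition virtual_boundary_arrow al (E : walk) : Prop :=
  virtual_arrow E /\ wvertices E `<=` al.

Definition virtual_behind e (E : walk) : Prop :=
  exists2 E0, end_segment E E0 & wvertices E0 `<=` behind e.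

Definition closest (A : set Q) i j : Prop :=
  A j /\ exists p : route j i, forall j' (p' : route j' i),
    A j' -> (rlength p <= rlength p')%N.

End Quivers.

Section Representations.
Variables (K : fieldType) (Q : quiver).

Record representation := Representation {
  space :> Q -> lmodType K;
  rmap : forall e : arrow Q, {linear space (src e) -> space (tgt e)} }.

Record subrep (V : representation) := Subrep {
  subrep_space :> forall i, submodClosed (V i);
  subrep_stable : forall e x, x \in subrep_space (src e) ->
    rmap V e x \in subrep_space (tgt e) }.

Definition rep_of_subrep (V : representation) (A : subrep V) : representation :=
  @Representation (fun i => subsp (A i)) (fun e => sub_map (@subrep_stable V A e)).

Definition quotrep (V : representation) (A : subrep V) : representation :=
  @Representation (fun i => quotsp (A i)) (fun e => quot_map (@subrep_stable V A e)).

Definition nonzero_rep (V : representation) : Prop := exists i (x : V i), x != 0.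

Definition nonzero_subrep V (A : subrep V) : Prop :=
  exists i (x : V i), x \in A i /\ x != 0.

Definition proper_subrep V (A : subrep V) : Prop :=
  exists i (x : V i), x \notin A i.

Definition direct_sum V (A B : subrep V) : Prop :=
  forall i, (forall x, x \in A i -> x \in B i -> x = 0) /\
    forall x, exists y z, [/\ y \in A i, z \in B i & x = y + z].

Definition indecomposable (V : representation) : Prop :=
  nonzero_rep V /\
  ~ exists A B : subrep V,
      [/\ proper_subrep A, nonzero_subrep A, proper_subrep B, nonzero_subrep B
        & direct_sum A B].

Definition isotypic (W : representation) : Prop :=
  exists (X : representation) (Y : lmodType K)
         (phi : forall i, {linear W i -> tensor (X i) Y}),
    [/\ indecomposable X, forall i, bijective (phi i)
      & forall e w, phi (tgt e) (rmap W e w) =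
                    tensor_map Y (rmap X e) (phi (src e) w)].

Section Filtration.
Variable V : representation.
Implicit Types (i j : Q) (e : arrow Q).

Fixpoint route_transport i j (p : route i j) (U : set (V i)) : set (V j) :=
  match p in route _ j return set (V j) with
  | Rnil => U
  | Rfwd e q => rmap V e @` route_transport q U
  | Rbwd e q => rmap V e @^-1` route_transport q U
  end.

(* In a tree there is exactly one injective route from i to j: see [transportE]. *)
Definition transport i (U : set (V i)) j : set (V j) :=
  [set x | forall p : route i j, injective_route p -> route_transport p U x].
Arguments transport : clear implicits.

Definition Vplus e i : set (V i) :=
  [set x | ~ behind e i -> transport (tgt e) setT i x].
Arguments Vplus : clear implicits.

Definition Vminus e i : set (V i) :=
  [set x | (in_front e i -> x = 0) /\
           (~ in_front e i -> transport (tgt e) [set 0] i x)].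
Arguments Vminus : clear implicits.

(* In a tree there is exactly one vertex of E closest to i: see [closest_uniq]. *)
Definition Vvirtual (E : walk Q) i : set (V i) :=
  [set x | ~ wvertices E i -> forall j, closest (wvertices E) i j ->
             transport j setT i x].
Arguments Vvirtual : clear implicits.

Definition Fset (al : set Q) i : set (V i) :=
  [set x | [/\ forall e, iba al e -> Vplus e i x,
               forall e, oba al e -> Vminus e i x
             & forall E, virtual_boundary_arrow al E -> Vvirtual E i x]].
Arguments Fset : clear implicits.

Definition Fbelow (al : set Q) i : set (V i) :=
  lspan (\bigcup_(be in [set be | sub_gt al be]) Fset be i).

End Filtration.
End Representations.

Arguments transport {K Q V} i U j _.
Arguments Vplus {K Q} V e i _.
Arguments Vminus {K Q} V e i _.
Arguments Vvirtual {K Q} V E i _.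
Arguments Fset {K Q} V al i _.
Arguments Fbelow {K Q} V al i _.

Section TreeWalks.
Variables (Q : quiver) (treeQ : is_tree Q).
Implicit Types (i j k v : Q) (e a : arrow Q).

Definition adjacent : rel Q := fun i j => `[< exists e, joins e i j >].

Lemma adjacent_sym : symmetric adjacent.
Proof.
by move=> i j; apply/asboolP/asboolP => -[e [] [<- <-]]; exists e;
  [right|left|right|left].
Qed.

Lemma rverts_path i j (p : route i j) : exists s,
  [/\ rverts p = i :: s, path adjacent i s, last i s = j & size s = rlength p].
Proof.
elim: p => [|e q [s [E P L S]]|e q [s [E P L S]]] /=.
- by exists [::].
- exists (rcons s (tgt e)); rewrite /rlength /= !size_rcons S last_rcons.
  by rewrite E rcons_path P L; split=> //; apply/asboolP; exists e; left.
- exists (rcons s (src e)); rewrite /rlength /= !size_rcons S last_rcons.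
  by rewrite E rcons_path P L; split=> //; apply/asboolP; exists e; right.
Qed.

Lemma path_route i s : path adjacent i s ->
  exists p : route i (last i s), rverts p = i :: s.
Proof.
elim/last_ind: s => [|s x IH]; first by exists (Rnil i).
rewrite rcons_path last_rcons => /andP[/IH[p E] /asboolP[e]].
rewrite -rcons_cons -E; move: p {E}; move: (last i s) => l p.
by case=> -[sE tE]; subst l x; [exists (Rfwd p)|exists (Rbwd p)].
Qed.

Lemma rlengthE i j (p : route i j) : size (rverts p) = (rlength p).+1.
Proof. by have [s [-> _ _ /= ->]] := rverts_path p. Qed.

Lemma last_rverts i j (p : route i j) v : last v (rverts p) = j.
Proof. by have [s [-> _ /= -> _]] := rverts_path p. Qed.

Lemma route_start i j (p : route i j) : i \in rverts p.
Proof. by have [s [-> _ _ _]] := rverts_path p; rewrite mem_head. Qed.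

Lemma route_end i j (p : route i j) : j \in rverts p.
Proof.
have [s [-> _ L _]] := rverts_path p.
by have := mem_last i s; rewrite L.
Qed.

Lemma path_acyclic i s :
  path adjacent i s -> last i s = i -> uniq s -> (size s <= 2)%N.
Proof.
move=> /path_route[p E] L Us; rewrite leqNgt; apply/negP => s2.
move: p E; rewrite L => p E.
have := tree_acyclic treeQ (p := p).
by have := rlengthE p; rewrite E /= Us => -[<-] /(_ s2).
Qed.

Lemma path_disjoint i s t m :
  path adjacent i (rcons s m) -> path adjacent i (rcons t m) ->
  uniq (i :: rcons s m) -> uniq (i :: rcons t m) -> ~~ has (mem s) t ->
  s = [::] /\ t = [::].
Proof.
move=> Ps Pt /= /andP[i_s Us] /andP[i_t Ut] st.
have Pc : path adjacent i (rcons s m ++ rcons (rev t) i).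
  rewrite cat_path Ps last_rcons -rev_cons -(belast_rcons i t m).
  rewrite -{1}(last_rcons i t m) rev_path.
  by rewrite (eq_path (e' := adjacent)) // => u v; rewrite adjacent_sym.
have Lc : last i (rcons s m ++ rcons (rev t) i) = i.
  by rewrite last_cat last_rcons.
have Uc : uniq (rcons s m ++ rcons (rev t) i).
  move: i_t Ut; rewrite mem_rcons rcons_uniq inE negb_or => /andP[_ i_t].
  move=> /andP[m_t Ut].
  rewrite cat_uniq Us rcons_uniq rev_uniq Ut mem_rev i_t /= andbT.
  rewrite has_rcons negb_or /= i_s has_rev /=; apply/hasPn => x xt /=.
  rewrite mem_rcons inE negb_or; apply/andP; split.
    by apply: contraNneq m_t => <-.
  by move/hasPn: st => /(_ x xt).
have := path_acyclic Pc Lc Uc.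
rewrite size_cat !size_rcons size_rev.
by move: s t {Ps i_s Us st Pc Lc Uc Pt i_t Ut} => [|? ?] [|? ?] //=; rewrite addnS.
Qed.

Lemma path_uniq i s t : path adjacent i s -> path adjacent i t ->
  uniq (i :: s) -> uniq (i :: t) -> last i s = last i t -> s = t.
Proof.
elim: s i t => [|y s IH] i [|z t] //.
- by move=> _ _ _ /= /andP[+ _] iE; rewrite {1}iE mem_last.
- by move=> _ _ /= /andP[+ _] _ iE; rewrite -{1}iE mem_last.
case: (eqVneq y z) => [<-|yz].
  move=> /= /andP[_ Ps] /andP[_ Pt] /andP[_ Us] /andP[_ Ut] L.
  by rewrite (IH y t).
move=> Ps Pt Us Ut L; exfalso.
have [m [t1 [t2 [tE ms t1s]]]] :
    exists m t1 t2, [/\ z :: t = rcons t1 m ++ t2, m \in y :: s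
                      & ~~ has (mem (y :: s)) t1].
  have : has (mem (y :: s)) (z :: t).
    apply/hasP; exists (last z t); first exact: mem_last.
    by move: L => /= <-; exact: mem_last.
  by case/split_find => m t1 t2 ? ?; exists m, t1, t2.
have [s1 [s2 sE]] : exists s1 s2, y :: s = rcons s1 m ++ s2.
  by case/splitPr: ms => s1 s2; exists s1, s2; rewrite cat_rcons.
rewrite tE in Pt Ut; rewrite sE in Ps Us t1s.
have [|||||s10 t10] := @path_disjoint i s1 t1 m.
- by move: Ps; rewrite cat_path => /andP[].
- by move: Pt; rewrite cat_path => /andP[].
- by move: Us; rewrite -cat_cons cat_uniq => /andP[].
- by move: Ut; rewrite -cat_cons cat_uniq => /andP[].
- apply: contra t1s => /hasP[x xt xs]; apply/hasP; exists x => //=.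
  by move: xs => /= xs; rewrite mem_cat mem_rcons inE xs orbT.
by move: sE tE yz; rewrite s10 t10 /= => -[-> _] [-> _]; rewrite eqxx.
Qed.

Lemma route_uniq i j (p q : route i j) :
  injective_route p -> injective_route q -> rverts p = rverts q.
Proof.
rewrite /injective_route.
have [s [-> Ps Ls _]] := rverts_path p; have [t [-> Pt Lt _]] := rverts_path q.
by move=> Us Ut; congr cons; apply: (path_uniq Ps Pt Us Ut); rewrite Ls Lt.
Qed.

Lemma route_shorten i j (p : route i j) : exists q : route i j,
  [/\ injective_route q, {subset rverts q <= rverts p}
    & (rlength q <= rlength p)%N].
Proof.
have [s [E Ps L S]] := rverts_path p.
move: L; case/shortenP: Ps => s' Ps' Us' ss' L.
have := path_route Ps'; rewrite L => -[q qE].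
exists q; split.
- by rewrite /injective_route qE.
- move=> x; rewrite qE E !inE => /orP[->//|/ss' ->]; exact: orbT.
- by rewrite -ltnS -!rlengthE qE E /= ltnS uniq_leq_size //; case/andP: Us'.
Qed.

Lemma injective_route_exists i j : exists p : route i j, injective_route p.
Proof.
have [p] := tree_connected treeQ i j.
by have [q []] := route_shorten p; exists q.
Qed.

Fixpoint rcat i j (p : route i j) k (q : route j k) : route i k :=
  match q in route _ k return route i k with
  | Rnil => p
  | Rfwd e r => Rfwd (rcat p r)
  | Rbwd e r => Rbwd (rcat p r)
  end.

Lemma rverts_cat i j (p : route i j) k (q : route j k) :
  rverts (rcat p q) = rverts p ++ behead (rverts q).
Proof.
elim: q => [|e r IH|e r IH] /=; first by rewrite cats0.
- by rewrite IH; have [s [-> _ _ _]] := rverts_path r; rewrite /= rcons_cat.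
- by rewrite IH; have [s [-> _ _ _]] := rverts_path r; rewrite /= rcons_cat.
Qed.

Lemma route_split i j (p : route i j) v : v \in rverts p ->
  exists (p1 : route i v) (p2 : route v j), p = rcat p1 p2.
Proof.
elim: p => [|e q IH|e q IH] /=.
- by rewrite inE => /eqP ->; exists (Rnil i), (Rnil i).
- rewrite mem_rcons inE => /orP[/eqP ->|/IH[p1 [p2 ->]]].
    by exists (Rfwd q), (Rnil _).
  by exists p1, (Rfwd p2).
- rewrite mem_rcons inE => /orP[/eqP ->|/IH[p1 [p2 ->]]].
    by exists (Rbwd q), (Rnil _).
  by exists p1, (Rbwd p2).
Qed.

Lemma injective_cat i j (p : route i j) k (q : route j k) :
  injective_route (rcat p q) -> injective_route p /\ injective_route q.
Proof.
rewrite /injective_route rverts_cat cat_uniq => /and3P[Up pq Uq]; split=> //.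
have := route_end p; move: Uq pq.
have [s [-> _ _ _]] := rverts_path q => /= -> /hasPn js jp; rewrite andbT.
by apply/negP => /js; rewrite /= jp.
Qed.

Lemma injective_fwd e : injective_route (Rfwd (Rnil (src e))).
Proof.
rewrite /injective_route /= inE andbT; apply/eqP.
exact: tree_loopless treeQ _.
Qed.

Lemma injective_bwd e : injective_route (Rbwd (Rnil (tgt e))).
Proof.
rewrite /injective_route /= inE andbT; apply/eqP => /esym.
exact: tree_loopless treeQ _.
Qed.

Lemma route_rev i j (p : route i j) :
  exists q : route j i, rverts q = rev (rverts p).
Proof.
have [s [E P L _]] := rverts_path p.
have Pr : path adjacent j (rev (belast i s)).
  rewrite -L rev_path (eq_path (e' := adjacent)) // => u v.
  by rewrite adjacent_sym.
have := path_route Pr.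
have -> : last j (rev (belast i s)) = i.
  by case: s L {E P Pr} => [<-//|y s _]; rewrite /= rev_cons last_rcons.
by case=> q qE; exists q; rewrite qE E [i :: s]lastI L rev_rcons.
Qed.

Lemma route_eq i j (p q : route i j) : rverts p = rverts q -> p = q.
Proof.
suff H k (r : route i k) (E : k = j) :
  rverts p = rverts r -> p = eq_rect k (route i) r j E by exact: (H _ q erefl).
elim: p k r E => [|e p IH|e p IH] k r.
- case: k / r => [|e r|e r] E /=; first by rewrite eq_axiomK.
  + by move/(congr1 size); rewrite size_rcons rlengthE.
  + by move/(congr1 size); rewrite size_rcons rlengthE.
- case: k / r => [|e' r|e' r] E /=.
  + by move/(congr1 size); rewrite size_rcons rlengthE.
  + move=> /rcons_inj[pr _].
    have sE : src e' = src e by rewrite -(last_rverts p i) pr last_rverts.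
    have ee' : e' = e by apply: (tree_simple treeQ); left.
    subst e'; rewrite eq_axiomK /=; congr Rfwd.
    by rewrite (IH _ r erefl).
  + move=> /rcons_inj[pr _].
    have sE : tgt e' = src e by rewrite -(last_rverts p i) pr last_rverts.
    have ee' : e' = e by apply: (tree_simple treeQ); right.
    by subst e'; case: (tree_loopless treeQ (e := e)).
- case: k / r => [|e' r|e' r] E /=.
  + by move/(congr1 size); rewrite size_rcons rlengthE.
  + move=> /rcons_inj[pr _].
    have sE : src e' = tgt e by rewrite -(last_rverts p i) pr last_rverts.
    have ee' : e' = e by apply: (tree_simple treeQ); right.
    by subst e'; case: (tree_loopless treeQ (e := e)).
  + move=> /rcons_inj[pr _].
    have sE : tgt e' = tgt e by rewrite -(last_rverts p i) pr last_rverts.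
    have ee' : e' = e by apply: (tree_simple treeQ); left.
    subst e'; rewrite eq_axiomK /=; congr Rbwd.
    by rewrite (IH _ r erefl).
Qed.

Lemma injective_route_unique i j (p q : route i j) :
  injective_route p -> injective_route q -> p = q.
Proof. by move=> Up Uq; exact/route_eq/route_uniq. Qed.

Section Closest.
Variable A : set Q.
Hypothesis connA : forall i j, A i -> A j ->
  exists p : route i j, [set` rverts p] `<=` A.

Lemma route_in i j : A i -> A j ->
  exists2 p : route i j, injective_route p & [set` rverts p] `<=` A.
Proof.
move=> Ai Aj; have [p pA] := connA Ai Aj.
have [q [Uq qp _]] := route_shorten p; exists q => // v /= vq.
exact/pA/qp.
Qed.

Definition shortest i j (p : route j i) : Prop :=
  forall j' (q : route j' i), A j' -> (rlength p <= rlength q)%N.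

Definition touching i j (p : route j i) : Prop :=
  [/\ A j, injective_route p & forall v, v \in rverts p -> A v -> v = j].

Lemma touching_uniq i j j' (p : route j i) (p' : route j' i) :
  touching p -> touching p' -> j = j'.
Proof.
move=> [Aj Up pA] [Aj' Up' p'A]; have [r Ur rA] := route_in Aj' Aj.
apply: p'A => //; have /route_uniq : injective_route (rcat r p).
  rewrite /injective_route rverts_cat cat_uniq; apply/and3P; split=> //.
    apply/hasPn => v vp; apply/negP => /rA Av.
    have [s [E _ _ _]] := rverts_path p; move: Up vp (pA v).
    rewrite /injective_route E /= inE => /andP[j_s _] vs.
    by rewrite vs orbT => /(_ isT Av) vj; rewrite vj (negPf j_s) in vs.
  have [s [E _ _ _]] := rverts_path p.
  by move: Up; rewrite /injective_route E => /andP[].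
move=> /(_ _ Up') <-; rewrite rverts_cat mem_cat.
by rewrite route_end.
Qed.

Lemma shortest_touching i j (p : route j i) :
  A j -> shortest p -> injective_route p -> touching p.
Proof.
move=> Aj sp Up; split=> // v vp Av.
have [p1 [p2 pE]] := route_split vp; have := sp _ p2 Av.
rewrite -ltnS -!rlengthE pE rverts_cat.
have [s1 [-> _ L1 _]] := rverts_path p1.
have [s2 [-> _ _ _]] := rverts_path p2.
rewrite /= size_cat !ltnS -[X in (_ <= X)%N]add0n leq_add2r leqn0.
by move=> /nilP s10; rewrite -L1 s10.
Qed.

Lemma shortest_exists i j : A j -> exists j0 (p : route j0 i),
  [/\ A j0, injective_route p & shortest p].
Proof.
move=> Aj; pose P n := `[< exists j (p : route j i), A j /\ rlength p = n >].
have exP : exists n, P n.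
  have [p] := tree_connected treeQ j i.
  by exists (rlength p); apply/asboolP; exists j, p.
have [n /asboolP[j0 [p [Aj0 pn]]] nmin] := ex_minnP exP.
have [q [Uq _ qp]] := route_shorten p; exists j0, q; split=> // j' r Aj'.
apply: leq_trans qp _; rewrite pn; apply: nmin.
by apply/asboolP; exists j', r.
Qed.

Lemma closest_touching i j : closest A i j <-> exists p : route j i, touching p.
Proof.
split=> [[Aj [p sp]]|[p tp]].
  have [q [Uq _ qp]] := route_shorten p; exists q.
  by apply: shortest_touching => // j' r /(sp j' r); apply: leq_trans.
have [Aj Up _] := tp; split=> //; exists p.
have [j0 [p0 [Aj0 Up0 sp0]]] := shortest_exists i Aj.
have tp0 := shortest_touching Aj0 sp0 Up0; have jj0 := touching_uniq tp tp0.
subst j0 => j' r /(sp0 j' r); apply: leq_trans.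
by rewrite -ltnS -!rlengthE (route_uniq Up Up0).
Qed.

Lemma closest_uniq i j j' : closest A i j -> closest A i j' -> j = j'.
Proof.
move=> /closest_touching[p tp] /closest_touching[p' tp'].
exact: touching_uniq tp tp'.
Qed.

End Closest.

End TreeWalks.

Section VirtualWalks.
Variable Q : quiver.

Lemma itv_convex (I : interval int) (x y z : int) :
  x \in I -> z \in I -> x <= y -> y <= z -> y \in I.
Proof.
case: I => l r; rewrite !itv_boundlr => /andP[lx _] /andP[_ zr] xy yz.
apply/andP; split; first by apply: le_trans lx _; rewrite bnd_simp.
by apply: le_trans zr; rewrite bnd_simp.
Qed.

Lemma walk_connected (E : walk Q) i j : wvertices E i -> wvertices E j ->
  exists p : route i j, [set` rverts p] `<=` wvertices E.
Proof.
have half n (k : nat) : n \in wdom E -> n + k%:Z \in wdom E ->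
    exists p : route (E n) (E (n + k%:Z)), [set` rverts p] `<=` wvertices E.
  move=> nE; elim: k => [|k IH].
    rewrite addr0 => _; exists (Rnil _) => v /=; rewrite inE => /eqP ->.
    by exists n.
  rewrite intS [1 + _]addrC addrA => kE; have kE' : n + k%:Z \in wdom E.
    by apply: (itv_convex nE kE); rewrite ?lerDl.
  have [p pE] := IH kE'; have [e] := walk_adj kE' kE.
  have xm : wvertices E (E (n + k%:Z + 1)) by exists (n + k%:Z + 1).
  move: p pE xm; 
  move: (E (n + k%:Z)) (E (n + k%:Z + 1)) => u w p pE xm.
  case=> -[sE tE]; subst u w; [exists (Rfwd p)|exists (Rbwd p)] => v /=;
    by rewrite mem_rcons inE => /orP[/eqP ->|/pE].
have mono n m : n \in wdom E -> m \in wdom E -> n <= m ->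
    exists p : route (E n) (E m), [set` rverts p] `<=` wvertices E.
  move=> nE mE nm; have mn : m = n + `|m - n|%N%:Z.
    by rewrite gez0_abs ?subr_ge0// subrKC.
  by rewrite mn in mE *; apply: half.
move=> [n nE <-] [m mE <-]; case: (leP n m) => [|/ltW] nm; first exact: mono.
have [p pE] := mono _ _ mE nE nm; have [q qp] := route_rev p.
by exists q => v /=; rewrite qp mem_rev => /pE.
Qed.

End VirtualWalks.

Section Stability.
Variables (K : fieldType) (Q : quiver) (treeQ : is_tree Q).
Variable V : representation K Q.
Implicit Types (i j : Q) (e a : arrow Q).

Lemma route_transport_subspace i j (p : route i j) (U : set (V i)) :
  is_subspace U -> is_subspace (route_transport p U).
Proof.
move=> sU; elim: p => [//|e q [q0 qD]|e q [q0 qD]] /=.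
- split; first by exists 0; rewrite // linear0.
  move=> b _ _ [x qx <-] [y qy <-]; exists (b *: x + y); first exact: qD.
  by rewrite linearP.
- split=> [|b x y qx qy]; rewrite /= ?linear0 // linearP; exact: qD.
Qed.

Lemma transport_subspace i j (U : set (V i)) :
  is_subspace U -> is_subspace (transport i U j).
Proof.
move=> sU; split=> [p _|b x y px py p Up].
  by have [] := route_transport_subspace p sU.
have [_ pD] := route_transport_subspace p sU.
by apply: pD; [exact: px|exact: py].
Qed.

Lemma transportE i j (p : route i j) (U : set (V i)) :
  injective_route p -> transport i U j = route_transport p U.
Proof.
move=> Up; apply/seteqP; split=> [x|x px q Uq]; first exact.
by rewrite -(injective_route_unique treeQ Up Uq).
Qed.

Lemma route_transport_cat i j (p : route i j) k (q : route j k) (U : set (V i)) :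
  route_transport (rcat p q) U = route_transport q (route_transport p U).
Proof. by elim: q => [//|e r IH|e r IH] /=; rewrite IH. Qed.

Lemma subspaceT (W : lmodType K) : is_subspace [set: W].
Proof. by []. Qed.

Lemma subspace0 (W : lmodType K) : is_subspace [set (0 : W)].
Proof. by split=> // b _ _ -> ->; rewrite scaler0 addr0. Qed.

Lemma Vplus_subspace e i : is_subspace (Vplus V e i).
Proof.
have [t0 tD] := transport_subspace i (@subspaceT (V (tgt e))).
by split=> [//|b x y hx hy ie]; apply: tD; [exact: hx|exact: hy].
Qed.

Lemma Vminus_subspace e i : is_subspace (Vminus V e i).
Proof.
have [t0 tD] := transport_subspace i (@subspace0 (V (tgt e))).
split=> [//|b x y [hx hx'] [hy hy']]; split=> ie.
  by rewrite hx // hy // scaler0 addr0.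
by apply: tD; [exact: hx'|exact: hy'].
Qed.

Lemma Vvirtual_subspace E i : is_subspace (Vvirtual V E i).
Proof.
split=> [iE j _|b x y hx hy iE j jE].
  by have [] := transport_subspace i (@subspaceT (V j)).
have [_ tD] := transport_subspace i (@subspaceT (V j)).
by apply: tD; [exact: hx|exact: hy].
Qed.

Lemma Fset_subspace al i : is_subspace (Fset V al i).
Proof.
split=> [|b x y [x1 x2 x3] [y1 y2 y3]].
  split=> e _; [exact: (Vplus_subspace e i).1|exact: (Vminus_subspace e i).1|].
  exact: (Vvirtual_subspace e i).1.
split=> e he.
- by apply: (Vplus_subspace e i).2; [exact: x1|exact: y1].
- by apply: (Vminus_subspace e i).2; [exact: x2|exact: y2].
- by apply: (Vvirtual_subspace e i).2; [exact: x3|exact: y3].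
Qed.

Lemma transport_stable k (U : set (V k)) a (x : V (src a)) :
  transport k U (src a) x -> transport k U (tgt a) (rmap V a x).
Proof.
move=> Ux q Uq; case: (boolP (src a \in rverts q)) => [|aq]; last first.
  apply: (Ux (Rbwd q)); rewrite /injective_route /= rcons_uniq aq.
  exact: Uq.
move=> /route_split[q1 [q2 qE]]; move: Uq.
rewrite qE => /injective_cat[Uq1 Uq2].
rewrite (injective_route_unique treeQ Uq2 (injective_fwd treeQ a)).
by exists x; [exact: Ux|].
Qed.

Lemma Vplus_stable e a (x : V (src a)) :
  Vplus V e (src a) x -> Vplus V e (tgt a) (rmap V a x).
Proof.
move=> hx nb; case: (pselect (behind e (src a))) => [[p ep]|nb']; last first.
  exact/transport_stable/hx.
have ae : a = e.
  apply: contrapT => ae; apply: nb; exists (Rfwd p) => /=.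
  by rewrite mem_rcons inE negb_or ep andbT; apply/eqP => /esym.
subst a => q Uq.
by rewrite (injective_route_unique treeQ Uq (_ : injective_route (Rnil _))).
Qed.

Lemma Vminus_stable e a (x : V (src a)) :
  Vminus V e (src a) x -> Vminus V e (tgt a) (rmap V a x).
Proof.
move=> [hx hx']; case: (pselect (in_front e (src a))) => [af|naf].
  rewrite hx // linear0; exact: (Vminus_subspace e _).1.
split=> [[p ep]|_]; last exact/transport_stable/hx'.
have ae : a = e.
  apply: contrapT => ae; apply: naf; exists (Rbwd p) => /=.
  by rewrite mem_rcons inE negb_or ep andbT; apply/eqP => /esym.
by subst a; exact: (hx' naf _ (injective_bwd treeQ e)).
Qed.

Lemma Vvirtual_stable E a (x : V (src a)) :
  Vvirtual V E (src a) x -> Vvirtual V E (tgt a) (rmap V a x).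
Proof.
have connE := @walk_connected Q E.
move=> hx ntE j jE; have [p [Ej Up pE]] := (closest_touching treeQ connE _ _).1 jE.
case: (boolP (src a \in rverts p)) => [ap|nap]; last first.
  apply: transport_stable; case: (pselect (wvertices E (src a))) => [Es|nEs].
    exfalso; have [r Ur rE] := route_in connE Ej Es.
    have tp : touching (wvertices E) (Rfwd (Rnil (src a))).
      split=> //; first exact: injective_fwd.
      by move=> v /=; rewrite !inE => /orP[/eqP //|/eqP -> /ntE].
    have ja := touching_uniq treeQ connE (And3 Ej Up pE) tp.
    by move: nap; rewrite -ja route_start.
  apply: hx => //; apply/(closest_touching treeQ connE); exists (Rbwd p); split=> //.
    by rewrite /injective_route /= rcons_uniq nap.
  by move=> v /=; rewrite mem_rcons inE => /orP[/eqP -> /nEs|/pE].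
apply: transport_stable; have [p1 [p2 pE']] := route_split ap.
case: (pselect (wvertices E (src a))) => [Es|nEs].
  have js := pE _ ap Es; move=> q Uq; subst j.
  by rewrite (injective_route_unique treeQ Uq (_ : injective_route (Rnil _))).
apply: hx => //; apply/(closest_touching treeQ connE); exists p1; split=> //.
  by move: Up; rewrite pE' => /injective_cat[].
by move=> v vp; apply: pE; rewrite pE' rverts_cat mem_cat vp.
Qed.

Lemma Fset_stable al a (x : V (src a)) :
  Fset V al (src a) x -> Fset V al (tgt a) (rmap V a x).
Proof.
move=> [x1 x2 x3]; split=> e he.
- exact/Vplus_stable/x1.
- exact/Vminus_stable/x2.
- exact/Vvirtual_stable/x3.
Qed.

Lemma Fbelow_stable al a (x : V (src a)) :
  Fbelow V al (src a) x -> Fbelow V al (tgt a) (rmap V a x).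
Proof.
move=> [s hs ->]; rewrite linear_sum.
exists [seq (c.1, rmap V a c.2) | c <- s].
  by move=> _ /mapP[c /hs[be gt_be cF] ->]; exists be => //; exact: Fset_stable.
by rewrite big_map; apply: eq_bigr => c _; rewrite linearZ.
Qed.

Definition Frep_space al i : submodClosed (V i) :=
  subspace_of (@Fset_subspace al i).

Lemma Frep_stable al e x : x \in Frep_space al (src e) ->
  rmap V e x \in Frep_space al (tgt e).
Proof. by move=> /subspace_ofE Fx; exact/subspace_ofE/Fset_stable. Qed.

Definition Frep al : subrep V := Subrep (@Frep_stable al).

Lemma Fbelow_in_Frep_subspace al i :
  is_subspace [set x : rep_of_subrep (Frep al) i | Fbelow V al i (val x)].
Proof.
have [s0 sD] := lspan_subspace
  (\bigcup_(be in [set be | sub_gt al be]) Fset V be i).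
by split=> [|b x y]; [exact: s0|exact: sD].
Qed.

Definition Fbelow_space al i : submodClosed (rep_of_subrep (Frep al) i) :=
  subspace_of (@Fbelow_in_Frep_subspace al i).

Lemma Fbelow_space_stable al e x : x \in Fbelow_space al (src e) ->
  rmap (rep_of_subrep (Frep al)) e x \in Fbelow_space al (tgt e).
Proof. by move=> /subspace_ofE Fx; apply/subspace_ofE; exact: Fbelow_stable. Qed.

Definition Fbelow_rep al : subrep (rep_of_subrep (Frep al)) :=
  Subrep (@Fbelow_space_stable al).

(* F be is contained in F al whenever al > be, so Fbelow_rep al, the preimage of
   Fbelow under the inclusion of F al into V, is the whole sum of the F be. *)
Definition Wrep al : representation K Q := quotrep (Fbelow_rep al).

End Stability.

(* Main.v *)
Require Import Defs.
From HB Require Import structures.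
From mathcomp Require Import all_boot all_order all_algebra.
From mathcomp Require Import boolp classical_sets cardinality.
From mathcomp Require Import zify freeg.
From Stdlib Require Import Relation_Operators.

(** The reason W = F al / sum of the F be, for be < al, is isotypic: it is zero
    outside al, and each arrow inside al acts on it by an isomorphism. Since al
    is a connected part of a tree, composing these isomorphisms and their
    inverses identifies every W i, i in al, with one fixed space W c, in a
    way compatible with all arrows; so W is the tensor product with W c of the
    representation that is one-dimensional on al, zero elsewhere, with identity
    maps along the arrows of al ([locally_constant_isotypic]). That
    representation is indecomposable because a summand that contains the
    generator at one vertex contains it at all others ([thin_summand]).

    Everything rests on the geometry of transports. Betweenness in the tree
    ([btw]) gives [transport_btw]: the transport from i to j factors through any
    vertex between them; hence, of two full spaces transported to a common vertex,
    the one that starts beyond the other becomes the smaller. The key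
    consequence is [Fset_transport]: every vector of F al at i lies in the
    transport of V v, for each v in al. One walks from i through v and further
    away inside al: either the walk is stopped by a boundary arrow of al, or it
    reaches a leaf, or it is infinite, and then its end is a virtual arrow by
    eventual outwardness. In each case a condition defining F al is found beyond
    v ([boundary_or_virtual_beyond]).

    Let e be an arrow in al. If f_e kills a vector x of F al, then x belongs to
    F be, where be < al is the part of al behind e ([kernel_Fset]), so x vanishes
    in W; this is the easy half of injectivity. For surjectivity, let be be any connected set containing e. The conditions of
    F be located in front of e are pulled back along f_e from the target, so a
    preimage x of y in F be has only to satisfy the conditions located behind e
    ([rear_condition_lift]). Each such condition taken alone is met by some
    preimage of y ([rear_condition_image]); the difficulty is to meet all of
    them at once. It disappears because there is essentially one: every
    condition behind e singles out a virtual arrow behind e, either itself or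
    one living in the region that a boundary arrow cuts off, and distinct
    conditions single out inequivalent virtual arrows, whereas by hypothesis only one
    virtual arrow lies behind e ([rear_condition_unique]). The hypothesis
    concerns e only, so the surjectivity holds for all be < al containing e at
    the same time, while for the other be < al the space F be vanishes at the
    target of e ([sub_gt_arrow]). Hence an element of the sum of the F be at the
    target lifts to an element of the same sum at the source ([Fbelow_lift]), and
    injectivity on the quotient follows.

    At a vertex i outside al, either an outgoing boundary arrow forces F al to be
    zero, or i lies behind an incoming boundary arrow b. Then adding to al the
    route from b to i and everything reachable from that route by oriented
    paths behind b gives a smaller element be < al with F al contained in F be at
    i: the new conditions are transports of the full space along oriented paths,
    and these impose at i nothing beyond what [Fset_transport] already gives at
    b ([Fset_outside]). *)

Set Implicit Arguments.
Unset Strict Implicit.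
Unset Printing Implicit Defensive.

Import Order.TTheory GRing.Theory Num.Theory.

Local Open Scope classical_set_scope.
Local Open Scope ring_scope.

(** * Betweenness in a tree *)

Section Geodesics.
Variables (Q : quiver) (treeQ : is_tree Q).
Implicit Types (i j k u v w x y z : Q) (a b d e : arrow Q) (A : set Q).

Definition geo i j : route i j := projT1 (cid (injective_route_exists treeQ i j)).

Definition dist i j : nat := rlength (geo i j).

(** Betweenness replaces all manipulations of explicit routes below: v lies between
    i and j when the geodesic from i to j visits v. In particular, for adjacent u
    and w, [btw i u w] says that i is on the side of u of the arrow joining them. *)
Definition btw i v j : Prop := v \in rverts (geo i j).

Lemma geoP i j : injective_route (geo i j).
Proof. by rewrite /geo; case: cid. Qed.

Lemma geoE i j (p : route i j) : injective_route p -> p = geo i j.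
Proof. by move=> Up; apply: (injective_route_unique treeQ Up); exact: geoP. Qed.

Lemma geo_cat i v j : btw i v j -> geo i j = rcat (geo i v) (geo v j).
Proof.
move=> /route_split[p [q E]]; have := geoP i j.
by rewrite E => /injective_cat[/geoE <- /geoE <-].
Qed.

Lemma rlength_cat i j (p : route i j) k (q : route j k) :
  rlength (rcat p q) = (rlength p + rlength q)%N.
Proof.
by elim: q => [|e q IH|e q IH] /=; rewrite ?addn0 // /rlength /= !size_rcons
  addnS; congr S.
Qed.

Lemma dist_btw i v j : btw i v j -> dist i j = (dist i v + dist v j)%N.
Proof. by move=> /geo_cat E; rewrite /dist E rlength_cat. Qed.

Lemma dist_le i j (p : route i j) : (dist i j <= rlength p)%N.
Proof. by have [q [/geoE -> _ le_qp]] := route_shorten p. Qed.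

Lemma dist_triangle i v j : (dist i j <= dist i v + dist v j)%N.
Proof. by rewrite -rlength_cat; exact: dist_le. Qed.

Lemma dist0 i j : dist i j = 0%N -> i = j.
Proof.
rewrite /dist; have [s [_ _ <- <-]] := rverts_path (geo i j).
by move=> /size0nil ->.
Qed.

Lemma geo_nil i : geo i i = Rnil i.
Proof. by rewrite -(@geoE i i (Rnil i)). Qed.

Lemma dist_sym i j : dist i j = dist j i.
Proof.
suff le u v : (dist u v <= dist v u)%N by apply/eqP; rewrite eqn_leq !le.
have [p pE] := route_rev (geo v u); apply: leq_trans (dist_le p) _.
by rewrite -ltnS -!rlengthE pE size_rev.
Qed.

Lemma btw_start i j : btw i i j. Proof. exact: route_start. Qed.

Lemma btw_end i j : btw i j j. Proof. exact: route_end. Qed.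

Lemma btw_sym i v j : btw i v j -> btw j v i.
Proof.
rewrite /btw; have [p pE] := route_rev (geo i j).
have /geoE <- : injective_route p by rewrite /injective_route pE rev_uniq; exact: geoP.
by rewrite pE mem_rev.
Qed.

Lemma btw_xx i v : btw i v i -> v = i.
Proof. by rewrite /btw geo_nil inE => /eqP. Qed.

Lemma btw_trans i v w j : btw i v w -> btw i w j -> btw i v j.
Proof. by move=> ivw /geo_cat; rewrite /btw => ->; rewrite rverts_cat mem_cat ivw. Qed.

Lemma btw_trans_r i v w j : btw i w j -> btw w v j -> btw i v j.
Proof. by move=> /btw_sym jwi /btw_sym jvw; exact/btw_sym/(btw_trans jvw). Qed.

Lemma btw_anti i v w : btw i v w -> btw i w v -> v = w.
Proof. by move=> /dist_btw E1 /dist_btw E2; apply: dist0; lia. Qed.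

Lemma adjacent_arrow u w : adjacent u w <-> exists e, joins e u w.
Proof. by split=> /asboolP. Qed.

Lemma adjacent_src e : adjacent (src e) (tgt e).
Proof. by apply/adjacent_arrow; exists e; left. Qed.

Lemma adjacent_tgt e : adjacent (tgt e) (src e).
Proof. by apply/adjacent_arrow; exists e; right. Qed.

Lemma adjacent_neq u w : adjacent u w -> u <> w.
Proof.
move=> /adjacent_arrow[e [] [<- <-]]; first exact: tree_loopless treeQ _.
by move=> /esym; apply: tree_loopless treeQ _.
Qed.

Lemma geo_fwd e : geo (src e) (tgt e) = Rfwd (Rnil (src e)).
Proof. by rewrite -(geoE (injective_fwd treeQ e)). Qed.

Lemma geo_bwd e : geo (tgt e) (src e) = Rbwd (Rnil (tgt e)).
Proof. by rewrite -(geoE (injective_bwd treeQ e)). Qed.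

Lemma rverts_geo_adjacent u w : adjacent u w -> rverts (geo u w) = [:: u; w].
Proof.
by move=> /adjacent_arrow[e [] [<- <-]]; rewrite ?geo_fwd ?geo_bwd.
Qed.

Lemma dist_adjacent u w : adjacent u w -> dist u w = 1%N.
Proof. by move=> /rverts_geo_adjacent E; apply/eqP; rewrite -eqSS -rlengthE E. Qed.

Lemma adjacent_btw i u w : adjacent u w -> btw i u w \/ btw i w u.
Proof.
move=> uw; case: (boolP (w \in rverts (geo i u))) => [|w_p]; [by right|left].
move: w_p (geoP i u) (route_end (geo i u)); rewrite /btw /injective_route.
case/adjacent_arrow: uw => e [] [<- <-]; move: (geo _ _) => p w_p Up u_p.
  rewrite -(@geoE _ _ (Rfwd p)) /injective_route /= ?rcons_uniq ?w_p//.
  by rewrite mem_rcons inE u_p orbT.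
rewrite -(@geoE _ _ (Rbwd p)) /injective_route /= ?rcons_uniq ?w_p//.
by rewrite mem_rcons inE u_p orbT.
Qed.

Lemma adjacent_btwN i u w : adjacent u w -> btw i u w -> ~ btw i w u.
Proof. by move=> /adjacent_neq uw iuw /(btw_anti iuw). Qed.

(** The geodesic from i to w enters w through its neighbour u, so any earlier point
    is already between i and u. *)
Lemma btw_pred i u w v : adjacent u w -> btw i u w -> btw i v w -> v <> w -> btw i v u.
Proof.
move=> uw /geo_cat; rewrite /btw => -> + vw.
by rewrite rverts_cat (rverts_geo_adjacent uw) mem_cat inE => /orP[|/eqP].
Qed.

Lemma pred_exists i v : v <> i -> exists2 u, adjacent u v & btw i u v.
Proof.
rewrite /btw; case: (geo i v) => [//|e p|e p] _.
- exists (src e); first exact: adjacent_src.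
  by rewrite /= mem_rcons inE route_end orbT.
- exists (tgt e); first exact: adjacent_tgt.
  by rewrite /= mem_rcons inE route_end orbT.
Qed.

Lemma succ_exists i v : v <> i -> exists2 u, adjacent i u & btw i u v.
Proof.
move=> vi; have [u iu vui] := @pred_exists v i (nesym vi).
by exists u; [rewrite adjacent_sym|exact: btw_sym].
Qed.

(** In a tree the two sides of an edge are joined by that edge alone. Distances
    decide: both ends of xy change theirs to u and to w by one, and crossing
    anywhere else makes these changes incompatible. *)
Lemma crossing_edge u w x y : adjacent u w -> adjacent x y ->
  btw x u w -> btw y w u -> x = u /\ y = w.
Proof.
move=> uw xy xuw ywu.
have Exuw := dist_btw xuw; have Eywu := dist_btw ywu.
have Euw := dist_adjacent uw; have Exy := dist_adjacent xy.
have Ewu := dist_adjacent (etrans (adjacent_sym w u) uw).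
have Eyx := dist_adjacent (etrans (adjacent_sym y x) xy).
have xu : x = u.
  case: (pselect (x = u)) => // xu; exfalso.
  case: (adjacent_btw u xy) => /btw_sym b1; have E1 := dist_btw b1.
    have wu : adjacent w u by rewrite adjacent_sym.
    have /dist_btw E2 := btw_pred wu ywu b1 xu.
    lia.
  case: (adjacent_btw w xy) => /dist_btw; rewrite !(dist_sym w); lia.
by split=> //; subst x; apply: dist0; lia.
Qed.

Lemma route_crossing u w i j (p : route i j) : adjacent u w ->
  btw i u w -> btw j w u -> u \in rverts p /\ w \in rverts p.
Proof.
move=> uw iuw; elim: p => [|e p IH|e p IH] /= jwu.
- by case: (adjacent_btwN uw iuw).
- rewrite !mem_rcons !inE; case: (adjacent_btw (src e) uw) => su.
    have [<- <-] := crossing_edge uw (adjacent_src e) su jwu.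
    by rewrite eqxx route_end orbT.
  by have [-> ->] := IH su; rewrite !orbT.
- rewrite !mem_rcons !inE; case: (adjacent_btw (tgt e) uw) => su.
    have [<- <-] := crossing_edge uw (adjacent_tgt e) su jwu.
    by rewrite eqxx route_end orbT.
  by have [-> ->] := IH su; rewrite !orbT.
Qed.

Lemma btw_crossing u w i j : adjacent u w -> btw i u w -> btw j w u ->
  btw i u j /\ btw i w j.
Proof. exact: route_crossing. Qed.

(** Leaving a side and coming back would traverse u twice, which the triangle
    inequality forbids. *)
Lemma side_convex u w i j v : adjacent u w -> btw i u w -> btw j u w ->
  btw i v j -> btw v u w.
Proof.
move=> uw iuw juw /dist_btw E; case: (adjacent_btw v uw) => // vwu; exfalso.
have [/dist_btw E1 _] := btw_crossing uw iuw vwu.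
have [/dist_btw E2 _] := btw_crossing uw juw vwu.
have D := dist_triangle i u j; rewrite (dist_sym j) (dist_sym j) in E2.
have vu : dist u v = 0%N by lia.
have := dist0 vu => vu'; subst v.
by apply: (adjacent_btwN uw _ vwu); exact: btw_start.
Qed.

Lemma not_front_side e x : ~ btw x (tgt e) (src e) <-> btw x (src e) (tgt e).
Proof.
split; first by case: (adjacent_btw x (adjacent_src e)).
exact/adjacent_btwN/adjacent_src.
Qed.

Lemma arrow_side a e : a <> e ->
  btw (src a) (src e) (tgt e) <-> btw (tgt a) (src e) (tgt e).
Proof.
move=> ae; split=> b1; apply/not_front_side => b2; apply: ae.
- have [? ?] := crossing_edge (adjacent_src e) (adjacent_src a) b1 b2.
  by apply/esym/(tree_simple treeQ); left.
- have [? ?] := crossing_edge (adjacent_src e) (adjacent_tgt a) b1 b2.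
  by apply/esym/(tree_simple treeQ); right.
Qed.

Lemma route_side e i j (p : route i j) : e \notin rarrows p ->
  btw i (src e) (tgt e) <-> btw j (src e) (tgt e).
Proof.
elim: p => [//|a p IH|a p IH] /=;
  rewrite mem_rcons inE negb_or => /andP[/eqP ea /IH ->];
  by have := arrow_side (nesym ea); tauto.
Qed.

Lemma rarrows_verts e i j (p : route i j) : e \in rarrows p ->
  src e \in rverts p /\ tgt e \in rverts p.
Proof.
elim: p => [//|a p IH|a p IH] /=; rewrite !mem_rcons !inE => /orP[/eqP ->|/IH[-> ->]];
  by rewrite ?route_end ?eqxx ?orbT.
Qed.

(** The definition speaks of routes that avoid e; in terms of betweenness,
    [btw_crossing] and [side_convex] apply. *)
Lemma behindE e i : behind e i <-> btw i (src e) (tgt e).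
Proof.
split=> [[p /route_side <-]|b1]; first exact: btw_start.
exists (geo (src e) i); apply/negP => /rarrows_verts[_ /btw_sym].
by apply: adjacent_btwN b1; exact: adjacent_src.
Qed.

Lemma in_frontE e i : in_front e i <-> btw i (tgt e) (src e).
Proof.
split=> [[p /route_side ps]|b1].
  apply: contrapT => /not_front_side/ps/not_front_side; apply; exact: btw_start.
exists (geo (tgt e) i); apply/negP => /rarrows_verts[/btw_sym + _].
by apply: adjacent_btwN b1; exact: adjacent_tgt.
Qed.

Lemma not_in_front e i : ~ in_front e i <-> behind e i.
Proof. by rewrite in_frontE behindE; exact: not_front_side. Qed.

Lemma not_behind e i : ~ behind e i <-> in_front e i.
Proof. by rewrite -not_in_front; split=> [/contrapT //|fi nfi]; exact: nfi. Qed.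

Lemma behind_src e : behind e (src e).
Proof. by apply/behindE; exact: btw_start. Qed.

Lemma in_front_tgt e : in_front e (tgt e).
Proof. by apply/in_frontE; exact: btw_start. Qed.

Lemma behind_arrow a e : a <> e -> behind e (src a) <-> behind e (tgt a).
Proof. by rewrite !behindE; exact: arrow_side. Qed.

Lemma behind_convex e i v j : behind e i -> behind e j -> btw i v j -> behind e v.
Proof. rewrite !behindE; apply: side_convex; exact: adjacent_src. Qed.

Lemma in_front_convex e i v j :
  in_front e i -> in_front e j -> btw i v j -> in_front e v.
Proof. rewrite !in_frontE; apply: side_convex; exact: adjacent_tgt. Qed.

Lemma behind_front_btw e i j : behind e i -> in_front e j ->
  btw i (src e) j /\ btw i (tgt e) j.
Proof. by rewrite behindE in_frontE; apply: btw_crossing; exact: adjacent_src. Qed.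

Lemma front_behind_btw e i j : in_front e i -> behind e j ->
  btw i (src e) j /\ btw i (tgt e) j.
Proof. by move=> ie je; have [/btw_sym ? /btw_sym ?] := behind_front_btw je ie. Qed.

(** Connectedness without nonemptiness, so that it also covers vertex sets of walks
    and intersections. *)
Definition linked A : Prop := forall i j, A i -> A j ->
  exists p : route i j, [set` rverts p] `<=` A.

Lemma linked_btw A i v j : linked A -> A i -> A j -> btw i v j -> A v.
Proof.
move=> cA Ai Aj; have [p /geoE -> pA] := route_in cA Ai Aj.
exact: pA.
Qed.

Lemma closest_exists A i j : A j -> exists k, closest A i k.
Proof.
by move=> /(shortest_exists treeQ i)[k [p [Ak _ sp]]]; exists k; split=> //; exists p.
Qed.

(** Concatenating a route inside A ending at j with the shortest route from j
    to i stays injective, as the latter meets A only at j. *)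
Lemma closest_btw A i j v : linked A -> closest A i j -> A v -> btw v j i.
Proof.
move=> cA /(closest_touching treeQ cA)[p [Aj Up pA]] Av.
have [r Ur rA] := route_in cA Av Aj.
have /geoE E : injective_route (rcat r p).
  rewrite /injective_route rverts_cat cat_uniq; apply/and3P; split=> //.
    apply/hasPn => x xp; apply/negP => /rA Ax.
    have [s [E _ _ _]] := rverts_path p; move: Up xp (pA x).
    rewrite /injective_route E /= inE => /andP[j_s _] xs.
    by rewrite xs orbT => /(_ isT Ax) xj; rewrite xj (negPf j_s) in xs.
  have [s [E _ _ _]] := rverts_path p.
  by move: Up; rewrite /injective_route E => /andP[].
by rewrite /btw -E rverts_cat mem_cat route_end.
Qed.

Lemma linked_front A e : linked A -> A (tgt e) -> ~ A (src e) -> A `<=` in_front e.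
Proof.
move=> cA At As i Ai; apply: contrapT => /not_in_front ib; apply: As.
by apply: (linked_btw cA Ai At); have [] := behind_front_btw ib (in_front_tgt e).
Qed.

Lemma linked_behind A e : linked A -> A (src e) -> ~ A (tgt e) -> A `<=` behind e.
Proof.
move=> cA As At i Ai; apply: contrapT => /not_behind ib; apply: At.
by apply: (linked_btw cA Ai As); have [] := front_behind_btw ib (behind_src e).
Qed.

Lemma ibaE A e : linked A -> iba A e <-> A (tgt e) /\ ~ A (src e).
Proof.
move=> cA; split=> [[[[As At]|[As At]] Af]|[At As]].
- by case: ((not_in_front e _).2 (behind_src e)); exact: Af.
- by [].
- by split; [right|exact: linked_front].
Qed.

Lemma obaE A e : linked A -> oba A e <-> A (src e) /\ ~ A (tgt e).
Proof.
move=> cA; split=> [[[[As At]|[As At]] Af]|[As At]].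
- by [].
- by case: ((not_behind e _).2 (in_front_tgt e)); exact: Af.
- by split; [left|exact: linked_behind].
Qed.

Lemma walk_linked (E : walk Q) : linked (wvertices E).
Proof. by move=> i j; exact: walk_connected. Qed.

(** * Walking away from a vertex *)

Section Explore.
Hypothesis outwardQ : eventually_outward Q.

(** Were there no arrow pointing further away from i, the arrow by which the
    geodesic from i enters z would be the only one at z. *)
Lemma arrow_beyond i z : z <> i -> ~ leaf z -> exists d w, joins d z w /\ btw i z w.
Proof.
move=> zi nlf; apply: contrapT => noE; apply: nlf.
have [u /adjacent_arrow[e0 e0uz] iuz] := pred_exists zi.
have uz : adjacent u z by apply/adjacent_arrow; exists e0.
have inc w d : joins d z w -> w = u.
  move=> dzw; have zw : adjacent z w by apply/adjacent_arrow; exists d.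
  have wz : adjacent w z by rewrite adjacent_sym.
  case: (adjacent_btw i zw) => [izw|iwz]; first by case: noE; exists d, w.
  apply: (@btw_anti i).
    by apply: btw_pred iwz _; rewrite //; exact: adjacent_neq.
  by apply: btw_pred iuz _; rewrite //; exact: adjacent_neq.
exists e0; split=> [|d dz]; first by case: e0uz => -[]; [right|left].
have [w dzw] : exists w, joins d z w.
  by case: dz => <-; [exists (tgt d); left|exists (src d); right].
have wu := inc _ _ dzw; subst w; apply: (tree_simple treeQ).
by move: e0uz dzw; rewrite /joins => -[[-> ->]|[-> ->]]; tauto.
Qed.

Definition singleton_walk z : walk Q.
Proof.
by exists `[0, 0] (fun=> z) => n; rewrite !in_itv /=; lia.
Defined.

Lemma singleton_virtual z : leaf z -> virtual_arrow (singleton_walk z).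
Proof.
move=> lz; have z0 : 0 \in wdom (singleton_walk z) by rewrite /= in_itv.
split.
- by exists 0; split=> // n; rewrite /= in_itv /=; lia.
- by move=> m n; rewrite /= !in_itv /=; lia.
- by move=> n; rewrite /= !in_itv /=; lia.
- by right; exists 0 => //; split=> // n; rewrite /= in_itv /=; lia.
Qed.

Definition ray (r : nat -> Q)
  (rS : forall n, exists e, joins e (r n) (r n.+1)) : walk Q.
Proof.
exists `[0, +oo[ (fun n => r (absz n)) => n.
rewrite !in_itv /= !andbT => n0 _.
have -> : absz (n + 1) = (absz n).+1 by lia.
exact: rS.
Defined.

Lemma ray_vertices (r : nat -> Q) rS z : wvertices (@ray r rS) z -> exists n, z = r n.
Proof. by move=> [n _ <-]; exists (absz n). Qed.

Lemma ray_journey (r : nat -> Q) rS : is_journey (@ray r rS).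
Proof. by exists 0; split=> [|n]; rewrite /= in_itv //= andbT. Qed.

Lemma ray_injective (r : nat -> Q) rS : injective r -> injective_walk (@ray r rS).
Proof.
move=> rI m n; rewrite /= !in_itv /= !andbT => m0 n0 /rI; lia.
Qed.

Lemma ray_virtual (r : nat -> Q) rS : injective r ->
  (forall n, exists e, src e = r n /\ tgt e = r n.+1) ->
  virtual_arrow (@ray r rS).
Proof.
move=> rI rO; split; [exact: ray_journey|exact: ray_injective| |left].
- move=> n; rewrite /= !in_itv /= !andbT => n0 _.
  have -> : absz (n + 1) = (absz n).+1 by lia.
  exact: rO.
- move=> /finite_seqP[s sE]; pose M := \max_(n <- s) absz n.
  have Ms : M.+1%:Z \in s.
    suff : [set` s] M.+1%:Z by [].
    by rewrite -sE /= in_itv.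
  by have := @leq_bigmax_seq _ s xpredT absz _ Ms isT; rewrite -/M ltnn.
Qed.

(** A form of Koenig's lemma. If neither alternative holds, then one can walk from v
    inside S, each time moving away from i, without ever being stopped by a
    boundary arrow or by a leaf (a leaf is a virtual arrow of one vertex). The
    resulting ray has finitely many arrows of the wrong orientation, and what
    follows them is a virtual arrow. *)
Lemma boundary_or_virtual_beyond (S : set Q) i v : S v -> v <> i ->
  (exists d z w, [/\ joins d z w, S z, ~ S w, btw i v z & btw i z w]) \/
  (exists E, [/\ virtual_arrow E, wvertices E `<=` S
               & forall z, wvertices E z -> btw i v z]).
Proof.
move=> Sv vi; apply: contrapT => /not_orP[noa nob].
pose P z := S z /\ btw i v z.
have next (t : {z | P z}) : exists t' : {z | P z},
    (exists d, joins d (sval t) (sval t')) /\ btw i (sval t) (sval t').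
  case: t => z [Sz ivz] /=; have zi : z <> i.
    by move=> zi; subst z; apply: vi; exact: btw_xx ivz.
  have nlf : ~ leaf z.
    move=> lz; apply: nob; exists (singleton_walk z); split.
    - exact: singleton_virtual.
    - by move=> _ [n _ <-].
    - by move=> _ [n _ <-].
  have [d [w [dzw izw]]] := arrow_beyond zi nlf.
  have Sw : S w by apply: contrapT => nSw; apply: noa; exists d, z, w; split.
  have Pw : P w by split=> //; exact: btw_trans izw.
  by exists (exist _ w Pw); split=> //; exists d.
have [f fP] := choice next.
pose t n := iter n f (exist P v (conj Sv (btw_end i v))).
pose x n := sval (t n).
have xS n : exists e, joins e (x n) (x n.+1) by have [] := fP (t n).
have xB n : btw i (x n) (x n.+1) by have [] := fP (t n).
have xP n : P (x n) by exact: svalP.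
have xD n : dist i (x n) = (dist i v + n)%N.
  elim: n => [|n IH]; first by rewrite addn0.
  have /dist_adjacent D1 : adjacent (x n) (x n.+1) by exact/adjacent_arrow.
  by rewrite (dist_btw (xB n)) IH D1 -addnA addn1.
have xI : injective x by move=> m n /(congr1 (dist i)); rewrite !xD; lia.
(* M bounds the distance to i of the inconsistent arrows, so the ray is outward
   from its M-th vertex on. *)
have := outwardQ (ray_journey xS) (@ray_injective x xS xI).
move=> /finite_seqP[s sE]; pose M := \max_(a <- s) dist i (src a).
have out n : exists e, src e = x (n + M)%N /\ tgt e = x (n + M).+1.
  have [e [[se te]|[se te]]] := xS (n + M)%N; first by exists e.
  have es : e \in s.
    suff : [set` s] e by [].
    rewrite -sE /=; exists (n + M)%N%:Z; split; rewrite ?se ?te ?in_itv //=.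
    by congr x; lia.
  have := @leq_bigmax_seq _ s xpredT (fun a => dist i (src a)) _ es isT.
  by rewrite -/M se xD; lia.
have yS n : exists e, joins e (x (n + M)%N) (x (n.+1 + M)%N) by exact: xS.
apply: nob; exists (ray yS); split.
- by apply: ray_virtual => // m n /xI; lia.
- by move=> _ /ray_vertices[n ->]; have [] := xP (n + M)%N.
- by move=> _ /ray_vertices[n ->]; have [] := xP (n + M)%N.
Qed.

End Explore.
Lemma virtual_closest (E : walk Q) i :
  virtual_arrow E -> exists j, closest (wvertices E) i j.
Proof.
move=> vE; have [m [mE _]] := va_journey vE.
by apply: (@closest_exists _ i (E m)); exists m.
Qed.

(** * Transports and the vectors of F al *)

Section Transport.
Variables (K : fieldType) (V : representation K Q).

Lemma transport_geo i (U : set (V i)) j :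
  transport i U j = route_transport (geo i j) U.
Proof. exact: transportE (geoP i j). Qed.

Lemma transport_btw i k j (U : set (V i)) : btw i k j ->
  transport i U j = transport k (transport i U k) j.
Proof. by move=> /geo_cat E; rewrite !transport_geo E route_transport_cat. Qed.

Lemma transportS i (U U' : set (V i)) j : U `<=` U' ->
  transport i U j `<=` transport i U' j.
Proof.
move=> UU'; rewrite !transport_geo; elim: (geo i j) => [//|e p IH|e p IH] /=.
- by move=> _ [x px <-]; exists x => //; exact: IH.
- by move=> x; exact: IH.
Qed.

Lemma transport_refl i (U : set (V i)) : transport i U i = U.
Proof. by rewrite transport_geo geo_nil. Qed.

Lemma transport_fwd e (U : set (V (src e))) :
  transport (src e) U (tgt e) = rmap V e @` U.
Proof. by rewrite transport_geo geo_fwd. Qed.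

Lemma transport_bwd e (U : set (V (tgt e))) :
  transport (tgt e) U (src e) = rmap V e @^-1` U.
Proof. by rewrite transport_geo geo_bwd. Qed.

Lemma transport_le i j k : btw j k i ->
  transport j [set: V j] i `<=` transport k [set: V k] i.
Proof. by move=> /transport_btw ->; apply: transportS. Qed.

Lemma transport_zero_le i j k (U : set (V j)) : is_subspace U -> btw j k i ->
  transport k [set (0 : V k)] i `<=` transport j U i.
Proof.
move=> sU /transport_btw ->; apply: transportS => _ ->.
by have [] := transport_subspace k sU.
Qed.

(** If i is behind e, the transport from the target starts with the preimage of
    the full space, which is full; otherwise it factors through the target. *)
Lemma transport_arrow e i :
  transport (src e) [set: V (src e)] i `<=` transport (tgt e) [set: V (tgt e)] i.
Proof.
case: (adjacent_btw i (adjacent_src e)) => /btw_sym b; last exact: transport_le.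
by rewrite (transport_btw _ b) transport_bwd preimage_setT.
Qed.

(** The condition found beyond v, seen from i, is transported through v; what
    arrives at v lies in V v. *)
Lemma Fset_transport (al : set Q) i v (x : V i) : eventually_outward Q ->
  linked al -> al v -> Fset V al i x -> transport v setT i x.
Proof.
move=> outwardQ cal al_v [Fi Fo FE].
case: (pselect (v = i)) => [->|vi]; first by rewrite transport_refl.
have [|] := boundary_or_virtual_beyond outwardQ al_v vi.
- move=> [d [z [w [dzw alz nalw ivz izw]]]].
  have ivw : btw i v w by exact: btw_trans izw.
  case: dzw => -[sE tE]; subst z w.
  + apply: (@transport_le i (tgt d) v); first exact: btw_sym.
    have /Fo[_ dx] : oba al d by apply/obaE.
    have nf : ~ in_front d i by exact/not_in_front/behindE.
    by apply: transportS (dx nf).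
  + apply: (@transport_le i (tgt d) v); first exact: btw_sym.
    have /Fi : iba al d by apply/ibaE.
    by apply; apply/not_behind/in_frontE.
- move=> [E [vE Eal Ev]].
  have iE : ~ wvertices E i by move=> /Ev/btw_xx.
  have [j jE] := virtual_closest i vE.
  apply: (@transport_le i j v); first by apply/btw_sym/Ev; case: jE.
  exact: FE jE.
Qed.

(** * The order on connected subquivers *)

Lemma btw_linked A : (forall i v j, A i -> A j -> btw i v j -> A v) -> linked A.
Proof. by move=> cA i j Ai Aj; exists (geo i j) => v /= vp; exact: cA vp. Qed.

Lemma linked_behindI A e : linked A -> linked (A `&` behind e).
Proof.
move=> cA; apply: btw_linked => i v j [Ai bi] [Aj bj] ivj.
by split; [exact: linked_btw ivj|exact: behind_convex ivj].
Qed.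

(** Passing to the part behind e adds the condition V^{e,-}. It is stronger than
    every condition of al located in front of e, since these are transported
    through the target of e and every subspace contains 0. *)
Lemma reduction_Fset (al : set Q) e i : linked al -> arrow_in al e ->
  Fset V (al `&` behind e) i `<=` Fset V al i.
Proof.
move=> cal [als alt] x [Fi Fo FE].
have cbe := linked_behindI (e := e) cal.
have /Fo[x0 xt] : oba (al `&` behind e) e.
  apply/obaE => //; split; first by split=> //; exact: behind_src.
  by move=> [_ /not_in_front]; apply; exact: in_front_tgt.
case: (pselect (in_front e i)) => [/x0 ->|/[dup] /not_in_front bi /xt{}xt].
  by have [] := Fset_subspace V al i.
have zero j (U : set (V j)) : is_subspace U -> in_front e j -> transport j U i x.
  move=> sU fj; apply: (@transport_zero_le i j (tgt e)) xt => //.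
  by have [] := front_behind_btw fj bi.
have ne d : ~ (al (src d) /\ al (tgt d)) -> d <> e by move=> nd de; subst d; exact: nd.
split=> [d|d|E].
- move=> /(ibaE d cal)[adt nads]; case: (pselect (behind e (tgt d))) => bt.
    by apply: Fi; apply/ibaE => //; split=> // -[].
  by move=> _; apply: zero; [exact: subspaceT|exact/not_behind].
- move=> /(obaE d cal)[ads nadt]; have /behind_arrow de : d <> e by apply: ne => -[].
  case: (pselect (behind e (src d))) => bs.
    by apply: Fo; apply/obaE => //; split=> // -[].
  split=> [fd|_]; last first.
    by apply: zero; [exact: subspace0|apply/not_behind => /de].
  exfalso; apply: bs.
  have bd : al `<=` behind d by exact: linked_behind.
  have [b1 _] := behind_front_btw (bd _ als) fd.
  exact: behind_convex (behind_src e) bi b1.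
- (* A virtual arrow that crosses e passes through the target of e. *)
  move=> [vE Eal]; case: (pselect (wvertices E `<=` behind e)) => [Eb|].
    by apply: FE; split=> // v Ev; split; [exact: Eal|exact: Eb].
  move=> /existsNP[v /not_implyP[Ev /not_behind fv]] iE j jE.
  case: (pselect (behind e j)) => [bj|/not_behind]; last first.
    by apply: zero; exact: subspaceT.
  have Ej : wvertices E j by case: jE.
  have Et : wvertices E (tgt e).
    have [_ b1] := behind_front_btw bj fv.
    exact: linked_btw (@walk_linked E) Ej Ev b1.
  apply: (@transport_le i (tgt e) j); first exact: closest_btw (@walk_linked E) jE Et.
  exact: transportS xt.
Qed.

(** The only condition of the smaller set that the larger one may lack is V^{e,+},
    and [Fset_transport] provides it: the source of e belongs to be. *)
Lemma enhancement_Fset (be : set Q) e i : eventually_outward Q -> linked be ->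
  arrow_in be e -> Fset V be i `<=` Fset V (be `&` in_front e) i.
Proof.
move=> outwardQ cbe [bes bet] x Fx; have [Fi Fo FE] := Fx.
have cal : linked (be `&` in_front e).
  apply: btw_linked => j v k [Aj fj] [Ak fk] jvk.
  by split; [exact: linked_btw jvk|exact: in_front_convex jvk].
split=> [d|d|E].
- move=> /(ibaE d cal)[[bdt fdt] nds]; case: (pselect (d = e)) => [->|ne].
    by move=> _; apply: transport_arrow (Fset_transport outwardQ cbe bes Fx).
  apply: Fi; apply/ibaE => //; split=> // bds; apply: nds; split=> //.
  by apply/not_behind => /(behind_arrow ne)/not_in_front.
- move=> /(obaE d cal)[[bds fds] ndt]; apply: Fo; apply/obaE => //; split=> // bdt.
  apply: ndt; split=> //; apply/not_behind.
  have ne : d <> e.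
    by move=> de; subst d; move/not_behind: fds; apply; exact: behind_src.
  by move=> /(behind_arrow ne)/not_in_front.
- by move=> [vE EE]; apply: FE; split=> // v /EE[].
Qed.

Lemma move_Fset (al be : set Q) i : eventually_outward Q -> linked al ->
  move al be -> Fset V be i `<=` Fset V al i.
Proof.
move=> outwardQ cal [[_ cbe] [[e ale ->]|[e bee ->]]].
  exact: reduction_Fset.
exact: enhancement_Fset.
Qed.

Lemma sub_gt_Fset (al be : set Q) i : eventually_outward Q -> linked al ->
  sub_gt al be -> Fset V be i `<=` Fset V al i.
Proof.
move=> outwardQ + gt_be; suff: linked al -> linked be /\ Fset V be i `<=` Fset V al i.
  by move=> H /H[].
elim: gt_be => {al be} [al be mv cal|al be ga _ IH1 _ IH2 cal].
  by split; [case: mv => -[]|exact: move_Fset].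
have [cbe F1] := IH1 cal; have [cga F2] := IH2 cbe.
by split=> //; exact: subset_trans F1.
Qed.

Lemma sub_gt_linked (al be : set Q) : linked al -> sub_gt al be -> linked be.
Proof.
by move=> + gt_be; elim: gt_be => {al be} [al be [[]]//|al be ga _ IH1 _ IH2 /IH1/IH2].
Qed.

(** A move that drops e cuts it off by an outgoing boundary arrow, and later moves
    never undo this: an enhancement only adds vertices behind incoming arrows,
    a further reduction cuts e off again. Since V^{a,-} is zero in front of a,
    F be then vanishes at the target of e. *)
Lemma sub_gt_arrow (al be : set Q) e : linked al -> arrow_in al e -> sub_gt al be ->
  arrow_in be e \/ exists2 a, oba be a & in_front a (tgt e).
Proof.
move=> cal ale gt_be.
pose P (ga : set Q) := arrow_in ga e \/
  exists a, [/\ ga (src a), ~ ga (tgt a) & in_front a (tgt e)].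
suff: linked be /\ P be.
  move=> [cbe [|[a [as_ at_ ae]]]]; first by left.
  by right; exists a => //; apply/obaE.
have: P al by left.
elim: gt_be cal => {al ale be} [al be [[_ cbe] mv] cal Pal|al be ga _ IH1 _ IH2 cal Pal].
  split=> //; case: mv => [[b alb ->]|[b beb alE]].
  - have bt : ~ (al `&` behind b) (tgt b).
      by move=> [_ /not_in_front]; apply; exact: in_front_tgt.
    have bs : (al `&` behind b) (src b) by split; [case: alb|exact: behind_src].
    case: Pal => [ale|[a [aas aat ae]]].
      case: (pselect (e = b)) => eb.
        by right; exists b; split=> //; rewrite eb; exact: in_front_tgt.
      case: (pselect (behind b (src e))) => [be_|be_]; [left|right].
        by case: ale => ? ?; split; split=> //; apply/(behind_arrow eb).
      by exists b; split=> //; apply/not_behind => /(behind_arrow eb).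
    right; case: (pselect (behind b (src a))) => [ba|ba].
      by exists a; split=> // -[].
    exists b; split=> //; apply/not_behind => be_; apply: ba.
    have ab : al `<=` behind a by exact: linked_behind.
    have [b1 _] := behind_front_btw (ab _ alb.1) ae.
    exact: behind_convex (behind_src b) be_ b1.
  - case: Pal => [[als alt]|[a [als alt ae]]].
      by left; move: als alt; rewrite alE => -[? _] [? _].
    right; exists a; split=> //; first by move: als; rewrite alE => -[].
    move: als alt; rewrite alE => -[bs fs] nt bt; apply: nt; split=> //.
    have ne : a <> b.
      by move=> ab; subst a; move/not_behind: fs; apply; exact: behind_src.
    by apply/not_behind => /(behind_arrow ne)/not_in_front.
by have [cbe Pbe] := IH1 cal Pal; exact: IH2.
Qed.

(** Being killed by f_e is exactly the condition V^{e,-} at the source of e, the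
    only condition that the part behind e adds. *)
Lemma kernel_Fset (al : set Q) e (x : V (src e)) : linked al -> arrow_in al e ->
  Fset V al (src e) x -> rmap V e x = 0 -> Fset V (al `&` behind e) (src e) x.
Proof.
move=> cal [als alt] [Fi Fo FE] fx0; have cbe := linked_behindI (e := e) cal.
split=> [d|d|E].
- move=> /(ibaE d cbe)[[adt bdt] nds]; apply: Fi; apply/ibaE => //; split=> // ads.
  apply: nds; split=> //; apply/behind_arrow => // de; subst d.
  by move/not_in_front: bdt; apply; exact: in_front_tgt.
- move=> /(obaE d cbe)[[ads bds] ndt]; case: (pselect (d = e)) => [->|ne].
    split=> [/not_behind|_]; first by case; exact: behind_src.
    by rewrite transport_bwd.
  apply: Fo; apply/obaE => //; split=> // adt; apply: ndt; split=> //.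
  exact/(behind_arrow ne).
- by move=> [vE EE]; apply: FE; split=> // v /EE[].
Qed.
(** * Virtual arrows and their end segments *)

Lemma tail_transport (E : walk Q) (n m : int) i : virtual_arrow E ->
  n \in wdom E -> m \in wdom E -> n <= m ->
  transport (E n) [set: V (E n)] i `<=` transport (E m) [set: V (E m)] i.
Proof.
move=> vE nE mE nm; have mn : m = n + (absz (m - n))%:Z.
  by rewrite gez0_abs ?subr_ge0 // subrKC.
rewrite mn in mE *; elim: (absz _) mE => [|k IH]; first by
  rewrite addr0 => _; apply: subset_refl.
have -> : n + k.+1%:Z = n + k%:Z + 1 by lia.
move=> kE1; have kE : n + k%:Z \in wdom E by apply: (itv_convex nE kE1); lia.
apply: (subset_trans (IH kE)).
have [e [<- <-]] := va_outward vE kE kE1; exact: transport_arrow.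
Qed.

Lemma end_segment_refl (E : walk Q) : virtual_arrow E -> end_segment E E.
Proof.
move=> vE; have [m [mE mmin]] := va_journey vE; exists 0; split.
  exists m => // n; rewrite addr0; case: (boolP (n \in wdom E)) => [nE|_].
    by rewrite mmin.
  by rewrite andbF.
by move=> n _; rewrite addr0.
Qed.

Lemma end_segment_vertices (E E0 : walk Q) : end_segment E E0 ->
  exists2 m : int, m \in wdom E & forall z, wvertices E0 z <->
    exists n : int, [/\ n \in wdom E, m <= n & E n = z].
Proof.
move=> [c [[m mE E0E] E0c]]; exists m => // z; split=> [[n nE0 <-]|[n [nE mn <-]]].
  by exists (n + c); rewrite -E0c //; move: nE0; rewrite /= E0E => /andP[-> ->].
have nE0 : n - c \in wdom E0 by rewrite E0E subrK mn.
by exists (n - c) => //; rewrite E0c // subrK.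
Qed.

(** For the inclusion of the left side, the vertex of E nearest to i is either in
    the end segment, or precedes it and [tail_transport] applies; if i itself is
    on E, the full space at i plays that part. *)
Lemma end_segment_virtual (E E0 : walk Q) i : virtual_arrow E ->
  end_segment E E0 -> Vvirtual V E i = Vvirtual V E0 i.
Proof.
move=> vE /end_segment_vertices[m mE E0E].
have E0sub z : wvertices E0 z -> wvertices E z.
  by move=> /E0E[n [nE _ <-]]; exists n.
apply/seteqP; split=> x Ex.
  move=> iE0 j0 j0E0; have /E0E[n0 [n0E mn0 En0]] : wvertices E0 j0 by case: j0E0.
  have [j Ej xj] : exists2 j, wvertices E j & transport j setT i x.
    case: (pselect (wvertices E i)) => [Ei|iE].
      by exists i => //; rewrite transport_refl.
    have [j jE] := virtual_closest i vE.
    by exists j; [case: jE|exact: Ex jE].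
  case: (pselect (wvertices E0 j)) => [E0j|nE0j].
    apply: transport_le xj; exact: closest_btw (@walk_linked E0) j0E0 E0j.
  case: Ej => n nE En; subst j j0.
  apply: (tail_transport (m := n0) vE nE n0E _ xj); apply: le_trans mn0.
  case: (leP n m) => [//|/ltW mn]; case: nE0j; apply/E0E; exists n; split=> //.
move=> iE j jE; have iE0 : ~ wvertices E0 i by move=> /E0sub.
have E0m : wvertices E0 (E m) by apply/E0E; exists m.
have [j0 j0E0] := closest_exists i E0m.
have E0j0 : wvertices E0 j0 by case: j0E0.
apply: transport_le (Ex iE0 _ j0E0).
exact: closest_btw (@walk_linked E) jE (E0sub _ E0j0).
Qed.

Lemma end_segments_meet (E E1 E2 : walk Q) : end_segment E E1 -> end_segment E E2 ->
  exists z, wvertices E1 z /\ wvertices E2 z.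
Proof.
move=> /end_segment_vertices[m1 m1E E1E] /end_segment_vertices[m2 m2E E2E].
case: (leP m1 m2) => [le12|/ltW le21].
  exists (E m2); split; [apply/E1E|apply/E2E]; exists m2; by split.
exists (E m1); split; [apply/E1E|apply/E2E]; exists m1; by split.
Qed.

(** The hypothesis of the theorem at e. End segments are absorbed in the
    equivalence of virtual arrows, so it suffices to consider those entirely
    behind e. *)
Definition one_end_behind e : Prop :=
  exists2 E0, virtual_arrow E0 & forall E, virtual_arrow E ->
    wvertices E `<=` behind e -> same_virtual_arrow E0 E.

Lemma one_end_meet e (E E' : walk Q) : one_end_behind e ->
  virtual_arrow E -> virtual_arrow E' ->
  wvertices E `<=` behind e -> wvertices E' `<=` behind e ->
  exists z, wvertices E z /\ wvertices E' z.
Proof.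
move=> [E0 vE0 E0u] vE vE' /(E0u _ vE)[T E0T ET] /(E0u _ vE')[T' E0T' ET'].
have [z [Tz T'z]] := end_segments_meet E0T E0T'.
have [m _ TE] := end_segment_vertices ET; have [m' _ TE'] := end_segment_vertices ET'.
exists z; split; first by have [n [nE _ <-]] := (TE z).1 Tz; exists n.
by have [n [nE _ <-]] := (TE' z).1 T'z; exists n.
Qed.

Lemma one_end_Vvirtual e (E E' : walk Q) i : one_end_behind e ->
  virtual_arrow E -> virtual_arrow E' ->
  wvertices E `<=` behind e -> wvertices E' `<=` behind e ->
  Vvirtual V E i = Vvirtual V E' i.
Proof.
move=> [E0 vE0 E0u] vE vE' /(E0u _ vE)[T E0T ET] /(E0u _ vE')[T' E0T' ET'].
rewrite (end_segment_virtual i vE ET) -(end_segment_virtual i vE0 E0T).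
by rewrite (end_segment_virtual i vE0 E0T') -(end_segment_virtual i vE' ET').
Qed.

(** * Conditions behind an arrow *)

(** Incoming and outgoing boundary arrows are treated together: exactly one of the
    two hypotheses holds for a boundary arrow of a connected set. *)
Definition boundary_set (be : set Q) d i : set (V i) :=
  [set x | (iba be d -> Vplus V d i x) /\ (oba be d -> Vminus V d i x)].
Arguments boundary_set : clear implicits.

Lemma FsetP (be : set Q) i (x : V i) : Fset V be i x <->
  (forall d, boundary_arrow be d -> boundary_set be d i x) /\
  (forall E, virtual_boundary_arrow be E -> Vvirtual V E i x).
Proof.
split=> [[Fi Fo FE]|[Fd FE]]; split=> // d.
- by move=> _; split=> [/Fi|/Fo].
- by move=> hd; have [bd _] := hd; have [+ _] := Fd d bd; apply.
- by move=> hd; have [bd _] := hd; have [_] := Fd d bd; apply.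
Qed.

Lemma boundaryP (be : set Q) d :
  boundary_arrow be d <-> exists u w, [/\ joins d u w, be u & ~ be w].
Proof.
split=> [[] []|[u [w [[] [<- <-] bu bw]]]].
- by exists (src d), (tgt d); split=> //; left.
- by exists (tgt d), (src d); split=> //; right.
- by left.
- by right.
Qed.

Lemma joins_adjacent d u w : joins d u w -> adjacent u w.
Proof. by move=> duw; apply/adjacent_arrow; exists d. Qed.

Lemma beyond_boundary (be : set Q) u w z : linked be ->
  be u -> ~ be w -> btw z w u -> ~ be z.
Proof. by move=> cbe bu bw zwu bz; apply: bw; apply: linked_btw zwu. Qed.

(** A vertex outside be is separated from be by a single boundary arrow, the one
    by which the geodesics from be to that vertex leave be. *)
Lemma boundary_disjoint (be : set Q) d d' u u' w w' z : linked be ->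
  joins d u w -> joins d' u' w' -> be u -> be u' -> ~ be w -> ~ be w' ->
  btw z w u -> btw z w' u' -> d = d'.
Proof.
move=> cbe duw duw' bu bu' bw bw' zwu zwu'.
have uw := joins_adjacent duw; have uw' := joins_adjacent duw'.
have wu : adjacent w u by rewrite adjacent_sym.
have uuw : btw u u' w'.
  by case: (adjacent_btw u uw') => // /(beyond_boundary cbe bu' bw').
case: (adjacent_btw w uw') => [wuw|wwu]; last first.
  have [? ?] := crossing_edge uw' uw uuw wwu; subst u' w'.
  apply: (tree_simple treeQ); move: duw duw'.
  by rewrite /joins => -[[-> ->]|[-> ->]]; tauto.
exfalso; have [wuz _] := btw_crossing uw' wuw zwu'.
have /(beyond_boundary cbe bu bw) : btw u' w u.
  by apply: (side_convex wu (btw_start w u) zwu wuz).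
by [].
Qed.

Lemma beyond_boundary_virtual (outwardQ : eventually_outward Q) u w : adjacent u w ->
  exists2 E, virtual_arrow E & forall z, wvertices E z -> btw z w u.
Proof.
move=> uw; have wu : w <> u by exact/nesym/adjacent_neq.
have [[?[?[?[]]]]//|[E [vE _ Ez]]] := @boundary_or_virtual_beyond outwardQ setT u w I wu.
by exists E => // z /Ez; exact: btw_sym.
Qed.
(** The conditions on F be at the source of e that do not follow from those at the
    target by taking preimages. *)
Definition rear_condition (be : set Q) e (D : set (V (src e))) : Prop :=
  (exists d, [/\ boundary_arrow be d, behind e (src d)
               & D = boundary_set be d (src e)]) \/
  (exists E, [/\ virtual_boundary_arrow be E, wvertices E `<=` behind e
               & D = Vvirtual V E (src e)]).

Lemma arrow_not_boundary (be : set Q) d e :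
  arrow_in be e -> boundary_arrow be d -> d <> e.
Proof. by move=> [bs bt] bd de; subst d; case: bd => -[]. Qed.

(** The condition at the target of e is the transport of a subspace starting
    behind e, so it factors through the source of e and is an image under f_e. *)
Lemma rear_condition_image (be : set Q) e (D : set (V (src e))) :
  linked be -> arrow_in be e -> rear_condition be D ->
  Fset V be (tgt e) `<=` rmap V e @` D.
Proof.
move=> cbe [bs bt] [[d [bd ed ->]]|[E [bE Ee ->]]] y [Fi Fo FE].
  have ne : d <> e by exact: (arrow_not_boundary (conj bs bt) bd).
  have td : behind e (tgt d) by apply/behind_arrow.
  have bT j (U : set (V j)) : behind e j ->
      transport j U (tgt e) = rmap V e @` transport j U (src e).
    move=> ej; have [b1 _] := behind_front_btw ej (in_front_tgt e).
    by rewrite (transport_btw _ b1) transport_fwd.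
  case: (pselect (be (tgt d))) => bdt.
    have ds : ~ be (src d) by case: bd => -[].
    have db : iba be d by apply/ibaE.
    have f j : be j -> in_front d j by exact: linked_front.
    have /(Fi _ db) : ~ behind d (tgt e) by apply/not_behind/f.
    rewrite bT // => -[x dx <-]; exists x => //; split=> [_ _ //|].
    by move=> /(obaE d cbe)[].
  have bds : be (src d) by case: bd => -[].
  have db : oba be d by apply/obaE.
  have f j : be j -> behind d j by exact: linked_behind.
  have [_ /(_ ((not_in_front _ _).2 (f _ bt)))] := Fo _ db.
  rewrite bT // => -[x dx <-]; exists x => //; split=> [/(ibaE d cbe)[]//|_].
  by split=> // ; move: (f _ bs) => /not_in_front.
have vE : virtual_arrow E by case: bE.
have Et : ~ wvertices E (tgt e).
  by move=> /Ee/not_in_front; apply; exact: in_front_tgt.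
have [j jE] := virtual_closest (tgt e) vE.
have Ej : wvertices E j by case: jE.
have [b1 _] := behind_front_btw (Ee _ Ej) (in_front_tgt e).
have := FE _ bE Et j jE; rewrite (transport_btw _ b1) transport_fwd => -[x jx <-].
exists x => // Es j' j'E; apply: transport_le jx.
exact: closest_btw (@walk_linked E) j'E Ej.
Qed.

(** Two boundary arrows cut off disjoint regions, and a virtual arrow inside be
    avoids both; so distinct conditions, one of which comes from a boundary
    arrow, would yield virtual arrows behind e with no common vertex, hence not
    equivalent. Equivalent virtual arrows impose the same condition. *)
Lemma rear_condition_unique (be : set Q) e (D D' : set (V (src e))) :
  eventually_outward Q -> linked be -> arrow_in be e -> one_end_behind e ->
  rear_condition be D -> rear_condition be D' -> D = D'.
Proof.
move=> outwardQ cbe bee one.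
have [bs bt] := bee.
(* Beyond each boundary arrow behind e there is a virtual arrow, avoiding be. *)
have cut d : boundary_arrow be d -> behind e (src d) -> exists u w E,
    [/\ joins d u w, be u, ~ be w, virtual_arrow E & wvertices E `<=` behind e /\
        forall z, wvertices E z -> btw z w u].
  move=> bd eds; have ne : d <> e by exact: arrow_not_boundary bd.
  have edt : behind e (tgt d) by apply/behind_arrow.
  have [u [w [duw bu bw]]] := (boundaryP _ _).1 bd.
  have uw := joins_adjacent duw.
  have ew : behind e w by case: duw => [[_ <-]|[<- _]].
  have wu : adjacent w u by rewrite adjacent_sym.
  have [E vE Ez] := beyond_boundary_virtual outwardQ uw.
  exists u, w, E; split=> //; split=> // z /Ez zwu.
  apply/not_in_front => fz; have [_ wtz] := behind_front_btw ew fz.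
  have := side_convex wu (btw_start w u) zwu wtz.
  by move=> /(beyond_boundary cbe bu bw).
case=> [[d [bd ed ->]]|[E [bE Ee ->]]] [[d' [bd' ed' ->]]|[E' [bE' Ee' ->]]].
- have [u [w [E [duw bu bw vE [Ee Ez]]]]] := cut d bd ed.
  have [u' [w' [E' [duw' bu' bw' vE' [Ee' Ez']]]]] := cut d' bd' ed'.
  have [z [/Ez b1 /Ez' b2]] := one_end_meet one vE vE' Ee Ee'.
  by rewrite (boundary_disjoint cbe duw duw' bu bu' bw bw' b1 b2).
- have [u [w [E [duw bu bw vE [Ee Ez]]]]] := cut d bd ed.
  have [vE' E'be] := bE'.
  have [z [/Ez b1 /E'be bz]] := one_end_meet one vE vE' Ee Ee'.
  by case: (beyond_boundary cbe bu bw b1).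
- have [u [w [E' [duw bu bw vE' [Ee' Ez]]]]] := cut d' bd' ed'.
  have [vE Ebe] := bE.
  have [z [/Ez b1 /Ebe bz]] := one_end_meet one vE' vE Ee' Ee.
  by case: (beyond_boundary cbe bu bw b1).
- by apply: one_end_Vvirtual one _ _ Ee Ee'; [case: bE|case: bE'].
Qed.

(** The conditions located in front of e are transported to the source through
    the target, where they hold for f_e x; the last step is a preimage. *)
Lemma rear_condition_lift (be : set Q) e (x : V (src e)) :
  linked be -> arrow_in be e -> Fset V be (tgt e) (rmap V e x) ->
  (forall D, rear_condition be D -> D x) -> Fset V be (src e) x.
Proof.
move=> cbe [bs bt] [Fi Fo FE] rear.
have fT j (U : set (V j)) : in_front e j ->
    transport j U (src e) = rmap V e @^-1` transport j U (tgt e).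
  move=> fj; have [_ b1] := front_behind_btw fj (behind_src e).
  by rewrite (transport_btw _ b1) transport_bwd.
apply/FsetP; split=> [d bd|E bE].
  case: (pselect (behind e (src d))) => [ed|nds].
    by apply: rear; left; exists d.
  have ndt : ~ behind e (tgt d).
    by rewrite -behind_arrow //; exact: (arrow_not_boundary (conj bs bt) bd).
  have {}nds : in_front e (src d) by apply/not_behind.
  have {}ndt : in_front e (tgt d) by apply/not_behind.
  split=> [db|db].
    have [dt ds] := (ibaE d cbe).1 db.
    move=> _; rewrite fT //; apply: (Fi _ db).
    exact/not_behind/(linked_front cbe dt ds).
  have [ds dt] := (obaE d cbe).1 db; have f := linked_behind cbe ds dt.
  have nf j : be j -> ~ in_front d j by move=> /f/not_in_front.
  split=> [/(nf _ bs)//|_]; rewrite fT //.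
  by have [_] := Fo _ db; apply; exact: nf.
case: (pselect (wvertices E `<=` behind e)) => [Ee|].
  by apply: rear; right; exists E.
move=> /existsNP[v /not_implyP[Ev /not_behind fv]].
move=> nEs j jE; have Ej : wvertices E j by case: jE.
have cE := @walk_linked E.
have js : j <> src e by move=> js; subst j.
have fj : in_front e j.
  apply: contrapT => /not_in_front bj; apply: nEs.
  by have [b1 _] := behind_front_btw bj fv; exact: linked_btw cE Ej Ev b1.
rewrite fT //; case: (pselect (wvertices E (tgt e))) => [Et|nEt].
  have jt : j = tgt e.
    have := closest_btw cE jE Et; rewrite /btw geo_bwd /= !inE => /orP[/eqP//|/eqP//].
  by subst j; rewrite /= transport_refl.
have [j' j'E] := virtual_closest (tgt e) bE.1.
have Ej' : wvertices E j' by case: j'E.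
have fj' : in_front e j'.
  apply: contrapT => /not_in_front bj'; apply: nEt.
  by have [_ b1] := behind_front_btw bj' fv; exact: linked_btw cE Ej' Ev b1.
apply: transport_le (FE _ bE nEt _ j'E).
have b1 := closest_btw cE jE Ej'.
have [_ b2] := front_behind_btw fj' (behind_src e).
exact: btw_pred (adjacent_tgt e) b2 b1 js.
Qed.

(** If there is a rear condition, it is the only one, and a preimage satisfying it
    satisfies all; if there is none, any preimage given by [Fset_transport] will
    do. *)
Lemma Fset_surjective (be : set Q) e : eventually_outward Q -> linked be ->
  arrow_in be e -> one_end_behind e ->
  Fset V be (tgt e) `<=` rmap V e @` Fset V be (src e).
Proof.
move=> outwardQ cbe bee one y Fy.
case: (pselect (exists D : set (V (src e)), rear_condition be D)) => [[D rD]|noD].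
  have [x Dx xy] := rear_condition_image cbe bee rD Fy; exists x => //.
  apply: (rear_condition_lift cbe bee); rewrite ?xy // => D' rD'.
  by rewrite -(rear_condition_unique outwardQ cbe bee one rD rD').
have := Fset_transport outwardQ cbe bee.1 Fy.
rewrite transport_fwd => -[x _ xy]; exists x => //.
apply: (rear_condition_lift cbe bee); rewrite ?xy // => D' rD'.
by case: noD; exists D'.
Qed.
(** * Vanishing outside al *)

(** The route from the target of b to i, thickened by all oriented paths that
    start on it, as far as this lies behind b. It is closed under all outgoing
    arrows but b, so its other boundary arrows are incoming. *)
Inductive swept b i : Q -> Prop :=
| swept_route u of btw (tgt b) u i & behind b u : swept b i u
| swept_arrow e of e <> b & swept b i (src e) : swept b i (tgt e).

Lemma swept_behind b i v : swept b i v -> behind b v.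
Proof. by elim=> // e eb _ /(behind_arrow eb). Qed.

(** A boundary arrow or virtual arrow met at v therefore imposes on i no more than
    the full space at the target of b does. *)
Lemma swept_transport b i v : swept b i v ->
  transport (tgt b) [set: V (tgt b)] i `<=` transport v [set: V v] i.
Proof.
elim=> [u ub _|e _ _ IH]; first exact: transport_le.
by apply: (subset_trans IH); exact: transport_arrow.
Qed.

Lemma linked_hub A c : (forall v, A v -> exists p : route c v, [set` rverts p] `<=` A) ->
  linked A.
Proof.
move=> hub i j /hub[p pA] /hub[q qA]; have [p' p'E] := route_rev p.
exists (rcat p' q) => v /=.
by rewrite rverts_cat mem_cat p'E mem_rev => /orP[/pA//|/mem_behead/qA//].
Qed.

Lemma linked_swept (al : set Q) b i : linked al -> al (tgt b) -> behind b i ->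
  linked (al `|` swept b i).
Proof.
move=> cal alb bi; apply: (@linked_hub _ (tgt b)) => v [alv|].
  by have [p _ pal] := route_in cal alb alv; exists p => z /pal; left.
elim=> {v} [u ub bu|e eb se [p pS]].
  exists (rcat (Rbwd (Rnil (tgt b))) (geo (src b) u)) => z.
  rewrite /= rverts_cat mem_cat !inE => /orP[/orP[]/eqP ->|/mem_behead zu].
  - by left.
  - right; apply: swept_route; last exact: behind_src.
    by have [] := front_behind_btw (in_front_tgt b) bi.
  - right; apply: swept_route; last exact: behind_convex (behind_src b) bu zu.
    have [tsu _] := front_behind_btw (in_front_tgt b) bu.
    exact: btw_trans (btw_trans_r tsu zu) ub.
exists (Rfwd p) => z /=; rewrite mem_rcons inE => /orP[/eqP ->|/pS//].
by right; exact: swept_arrow.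
Qed.

Lemma Fbelow_subspace (al : set Q) i : is_subspace (Fbelow V al i).
Proof. exact: lspan_subspace. Qed.

(** The element of the order below al that contains F al at i is al enlarged by
    [swept b i], where b is the boundary arrow of al towards i. *)
Lemma Fset_outside (al : set Q) i (x : V i) : eventually_outward Q ->
  connected_subquiver al -> ~ al i -> Fset V al i x -> Fbelow V al i x.
Proof.
move=> outwardQ [[v0 al0] cal] nali Fx.
have [c cC] := closest_exists i al0; have alc : al c by case: cC.
have ic : i <> c by move=> ic; subst c.
have [w cw cwi] := succ_exists ic.
have nalw : ~ al w.
  move=> /(closest_btw cal cC)/btw_sym b1; apply: (adjacent_neq cw).
  exact: btw_anti b1 (btw_sym cwi).
have [Fi Fo FE] := Fx; have [b bcw] := (adjacent_arrow _ _).1 cw.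
case: bcw => -[sE tE]; subst c w.
  have /Fo[x0 _] : oba al b by apply/obaE.
  rewrite x0; first by have [] := Fbelow_subspace al i.
  exact/in_frontE/btw_sym.
(* From here on b points towards al, its target c is the vertex of al nearest
   to i, and i is behind b. *)
have bi : behind b i by exact/behindE/btw_sym.
have alf : al `<=` in_front b by exact: linked_front.
have disj v : al v -> ~ swept b i v by move=> /alf fv /swept_behind/not_in_front.
have sb : swept b i (src b) by apply: swept_route cwi _; exact: behind_src.
have cbe := linked_swept cal alc bi.
apply: sub_lspan; exists (al `|` swept b i).
  apply: t_step; split; first by split=> //; exists v0; left.
  right; exists b; first by split; [right|left].
  apply/seteqP; split=> [v alv|v [[//|/swept_behind/not_in_front nf] /nf//]].
  by split; [left|exact: alf].
have tx v : swept b i v -> transport v setT i x.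
  by move=> /swept_transport; apply; exact: Fset_transport Fx.
split=> [d|d|E].
- move=> /(ibaE d cbe)[[dt|dt] nds] nbi; last exact: tx.
  by apply: (Fi d _ nbi); apply/ibaE => //; split=> // ds; apply: nds; left.
- move=> /(obaE d cbe)[ds ndt].
  have alds : al (src d).
    case: ds => // ds; exfalso; apply: ndt; case: (pselect (d = b)) => [->|db].
      by left.
    by right; exact: swept_arrow.
  by apply: (Fo d); apply/obaE => //; split=> // dt; apply: ndt; left.
- move=> [vE Ebe]; case: (pselect (wvertices E `<=` al)) => [Eal|]; first exact: FE.
  move=> /existsNP[v /not_implyP[Ev nalv]] nEi j jE.
  have sv : swept b i v by case: (Ebe _ Ev).
  have Ej : wvertices E j by case: jE.
  case: (Ebe _ Ej) => [alj|]; last exact: tx.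
  exfalso; have /alf/not_behind := alj; apply.
  exact: behind_convex (swept_behind sv) bi (closest_btw (@walk_linked E) jE Ev).
Qed.
(** * The quotient W *)

Lemma subspaceB (U : lmodType K) (A : set U) : is_subspace A ->
  forall (u v : U), A u -> A v -> A (u - v).
Proof. by move=> [_ AD] u v Au Av; rewrite addrC -scaleN1r; exact: AD. Qed.

Lemma Fset_Fbelow (al be : set Q) i : sub_gt al be -> Fset V be i `<=` Fbelow V al i.
Proof. by move=> gt_be x Fx; apply: sub_lspan; exists be. Qed.

(** Termwise: a summand in F be lifts by surjectivity when be contains e, and is
    zero otherwise. The lift is also kept inside F al, so that subtracting it
    from a vector of F al leaves a vector of F al. *)
Lemma Fbelow_lift (al : set Q) e : eventually_outward Q -> linked al ->
  arrow_in al e -> one_end_behind e ->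
  Fbelow V al (tgt e) `<=` rmap V e @` (Fset V al (src e) `&` Fbelow V al (src e)).
Proof.
move=> outwardQ cal ale one _ [s sF ->].
elim: s sF => [_|[a y] s IH sF].
  exists 0; last by rewrite big_nil linear0.
  by split; [have [] := Fset_subspace V al (src e)|have [] := Fbelow_subspace al (src e)].
have [c cs|x [Fx Bx] xE] := IH; first by apply: sF; rewrite inE cs orbT.
have [be gt_be /= Fy] := sF _ (mem_head _ _).
have cbe := sub_gt_linked cal gt_be; rewrite big_cons -xE /=.
have [z Fz <-] : exists2 z, Fset V be (src e) z & rmap V e z = y.
  case: (sub_gt_arrow cal ale gt_be) => [bee|[b ob fb]].
    exact: (Fset_surjective outwardQ cbe bee one Fy).
  exists 0; first by have [] := Fset_subspace V be (src e).
  by case: Fy => _ /(_ b ob)[-> // _] _; rewrite linear0.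
exists (a *: z + x); last by rewrite linearP.
split; first by apply: (Fset_subspace V al (src e)).2 => //; exact: sub_gt_Fset Fz.
by apply: (Fbelow_subspace al (src e)).2 => //; exact: Fset_Fbelow Fz.
Qed.

Local Notation W al := (Wrep treeQ V al).

(** Elements of W are classes of vectors of V; this hides the two-step
    construction as a quotient of a subrepresentation. *)
Definition Wclass (al : set Q) i (x : V i) (Fx : Fset V al i x) : W al i :=
  quotsp_pi (Fbelow_space treeQ V al i)
    (exist _ x ((subspace_ofE (Fset_subspace V al i) x).2 Fx)).

Lemma WclassP (al : set Q) i (w : W al i) :
  exists (x : V i) (Fx : Fset V al i x), w = Wclass Fx.
Proof.
have [[x xF] ->] := quotsp_pi_surj w; exists x.
exists ((subspace_ofE _ x).1 xF); congr quotsp_pi; exact: val_inj.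
Qed.

Lemma Wclass_eq (al : set Q) i (x y : V i) (Fx : Fset V al i x) (Fy : Fset V al i y) :
  Wclass Fx = Wclass Fy <-> Fbelow V al i (x - y).
Proof. by rewrite /Wclass quotsp_eq; exact: subspace_ofE. Qed.

Lemma Wclass0 (al : set Q) i (x : V i) (Fx : Fset V al i x) :
  Wclass Fx = 0 <-> Fbelow V al i x.
Proof.
have F0 := (Fset_subspace V al i).1.
have -> : 0 = Wclass F0.
  by rewrite /Wclass -[LHS](linear0 (quotsp_pi _)); congr quotsp_pi; exact: val_inj.
by rewrite Wclass_eq subr0.
Qed.

Lemma Wclass_rmap (al : set Q) e (x : V (src e)) (Fx : Fset V al (src e) x) :
  rmap (W al) e (Wclass Fx) = Wclass (Fset_stable treeQ Fx).
Proof.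
rewrite /Wclass /=; apply: (etrans (quot_map_funE _ _)).
  by move=> z; exact: Fbelow_space_stable.
by congr quotsp_pi; exact: val_inj.
Qed.

Lemma W_outside (al : set Q) i (w : W al i) : eventually_outward Q ->
  connected_subquiver al -> ~ al i -> w = 0.
Proof.
move=> outwardQ cal nali; have [x [Fx ->]] := WclassP w.
exact/Wclass0/Fset_outside.
Qed.

Lemma W_surjective (al : set Q) e (w : W al (tgt e)) : eventually_outward Q ->
  linked al -> arrow_in al e -> one_end_behind e -> exists t, rmap (W al) e t = w.
Proof.
move=> outwardQ cal ale one; have [y [Fy ->]] := WclassP w.
have [x Fx xy] := Fset_surjective outwardQ cal ale one Fy.
exists (Wclass Fx); rewrite Wclass_rmap; subst y.
by apply/Wclass_eq; rewrite subrr; exact: (Fbelow_subspace _ _).1.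
Qed.

(** If f_e x is in the sum of the F be, lift it to y in that sum at the source;
    then x - y is killed by f_e and [kernel_Fset] puts it in F of the part of al
    behind e, which is below al. *)
Lemma W_injective (al : set Q) e : eventually_outward Q ->
  connected_subquiver al -> arrow_in al e -> one_end_behind e ->
  injective (rmap (W al) e).
Proof.
move=> outwardQ [_ cal] ale one.
suff ker0 (t : W al (src e)) : rmap (W al) e t = 0 -> t = 0.
  move=> t t' tt'; apply/eqP; rewrite -subr_eq0; apply/eqP/ker0.
  by rewrite linearB tt' subrr.
have [x [Fx ->]] := WclassP t; rewrite Wclass_rmap => /Wclass0 Bfx.
have [y [Fy By] yx] := Fbelow_lift outwardQ cal ale one Bfx.
apply/Wclass0; rewrite -(subrK y x).
rewrite -[x - y]scale1r; apply: (Fbelow_subspace al (src e)).2 => //.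
apply: (@Fset_Fbelow _ (al `&` behind e)).
  apply: t_step; split; last by left; exists e.
  split; last exact: linked_behindI.
  by exists (src e); split; [case: ale|exact: behind_src].
apply: kernel_Fset => //; last by rewrite linearB /= yx subrr.
exact: subspaceB (Fset_subspace V al (src e)) _ _ Fx Fy.
Qed.

End Transport.
End Geodesics.
(** * Tensor products *)

Section Tensors.
Variable K : fieldType.
Implicit Types X Y Z U : lmodType K.

Lemma linear_inverse X Y (f : {linear X -> Y}) : injective f ->
  (forall y, exists x, f x = y) ->
  exists2 g : {linear Y -> X}, cancel f g & cancel g f.
Proof.
move=> fI /choice[g fK]; have gK x : g (f x) = x by apply: fI; rewrite fK.
have g_lin : linear g by move=> a u v; apply: fI; rewrite linearP !fK.
pose gL : {linear Y -> X} := HB.pack g (GRing.isLinear.Build K Y X *:%R g g_lin).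
by exists gL.
Qed.

Lemma tensor_ind X Y (P : set (tensor X Y)) : is_subspace P ->
  (forall x y, P (pure x y)) -> forall t, P t.
Proof.
move=> [P0 PD] Pp t; have [z ->] := quotsp_pi_surj t.
rewrite -(freeg_sumE z) linear_sum /=.
elim: (dom z) => [|[x y] s IH]; first by rewrite big_nil.
rewrite big_cons; have -> : << coeff (x, y) z *g (x, y) >> =
    coeff (x, y) z *: (<< (x, y) >> : {freeg (X * Y)%type / K}).
  by apply/eqP/freeg_eqP => q; rewrite coeffZ !coeffU mul1r.
by rewrite linearZ; apply: PD => //; exact: Pp.
Qed.

Lemma pure_linear_l X Y (y : Y) : linear (fun x : X => pure x y).
Proof.
move=> a x x'; have pZ b u : pure (b *: u) y = b *: pure u y :> tensor X Y.
  rewrite /pure -linearZ; apply/quotsp_eq/subspace_ofE/sub_lspan.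
  by apply: Or43; exists b, u, y.
rewrite -pZ /pure -linearD; apply/quotsp_eq/subspace_ofE/sub_lspan.
by apply: Or41; exists (a *: x), x', y; rewrite opprD addrA.
Qed.

Lemma pure_linear_r X Y (x : X) : linear (fun y : Y => pure x y).
Proof.
move=> a y y'; have pZ b u : pure x (b *: u) = b *: pure x u :> tensor X Y.
  rewrite /pure -linearZ; apply/quotsp_eq/subspace_ofE/sub_lspan.
  by apply: Or44; exists b, x, u.
rewrite -pZ /pure -linearD; apply/quotsp_eq/subspace_ofE/sub_lspan.
by apply: Or42; exists x, (a *: y), y'; rewrite opprD addrA.
Qed.

Definition pure_r X Y (x : X) : {linear Y -> tensor X Y} :=
  HB.pack (fun y : Y => pure x y)
    (GRing.isLinear.Build K Y (tensor X Y) *:%R _ (pure_linear_r x)).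

Definition pure_l X Y (y : Y) : {linear X -> tensor X Y} :=
  HB.pack (fun x : X => pure x y)
    (GRing.isLinear.Build K X (tensor X Y) *:%R _ (pure_linear_l y)).

(** The universal property of the tensor product. *)
Lemma tensor_lift X Y Z (b : X -> Y -> Z) :
  (forall x, linear (b x)) -> (forall y, linear (b^~ y)) ->
  exists f : {linear tensor X Y -> Z}, forall x y, f (pure x y) = b x y.
Proof.
move=> bl br.
have [L0 L0E] : exists L : {linear {freeg (X * Y)%type / K} -> Z},
    forall x y, L << (x, y) >> = b x y.
  pose L : {linear {freeg (X * Y)%type / K} -> Z} :=
    HB.pack (fglift (fun p : X * Y => b p.1 p.2))
     (GRing.isLinear.Build K {freeg (X * Y)%type / K} Z *:%R _ (fglift_linear _)).
  by exists L => x y; rewrite /= liftU scale1r.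
have bDr x y y' : b x (y + y') = b x y + b x y'.
  by have := bl x 1 y y'; rewrite !scale1r.
have b0r x : b x 0 = 0 by apply: (addrI (b x 0)); rewrite -bDr !addr0.
have bZr x a y : b x (a *: y) = a *: b x y.
  by have := bl x a y 0; rewrite !addr0 b0r addr0.
have bDl x x' y : b (x + x') y = b x y + b x' y.
  by have := br y 1 x x'; rewrite !scale1r.
have b0l y : b 0 y = 0 by apply: (addrI (b 0 y)); rewrite -bDl !addr0.
have bZl x a y : b (a *: x) y = a *: b x y.
  by have := br y a x 0; rewrite !addr0 b0l addr0.
have L00 z : z \in tensor_ker X Y -> L0 z = 0.
  move=> /subspace_ofE[s hs ->]; rewrite linear_sum big_seq big1 // => c /hs hc.
  rewrite linearZ /=; case: hc => -[u [v [w ->]]].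
  - by rewrite !(linearB L0) /= !L0E bDl -addrA -opprD subrr scaler0.
  - by rewrite !(linearB L0) /= !L0E bDr -addrA -opprD subrr scaler0.
  - by rewrite (linearB L0) (linearZ_LR L0) /= !L0E bZl subrr scaler0.
  - by rewrite (linearB L0) (linearZ_LR L0) /= !L0E bZr subrr scaler0.
pose f (t : tensor X Y) : Z := L0 (repr t).
have fE z : f (quotsp_pi (tensor_ker X Y) z) = L0 z.
  apply/eqP; rewrite -subr_eq0 /f -linearB; apply/eqP/L00.
  by apply/quotsp_eq; rewrite /quotsp_pi reprK.
have f_lin : linear f.
  move=> a t t'; have [z ->] := quotsp_pi_surj t; have [z' ->] := quotsp_pi_surj t'.
  by rewrite -linearP !fE linearP.
pose F : {linear tensor X Y -> Z} :=
  HB.pack f (GRing.isLinear.Build K (tensor X Y) Z *:%R _ f_lin).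
by exists F => x y; rewrite /= fE L0E.
Qed.

(** Here X is a line with generator e and coordinate h; the inverse sends a pure
    tensor x, y to h x times y. *)
Lemma pure_line_bijective X Y (e : X) (h : {linear X -> K^o}) :
  h e = 1 -> (forall x, x = h x *: e) -> bijective (pure_r Y e).
Proof.
move=> he hE; have [|y a x x'|f fE] := @tensor_lift X Y Y (fun x y => h x *: y).
- by move=> x a u v; rewrite scalerDr !scalerA mulrC.
- by rewrite linearP scalerDl scalerA.
exists f => [y|]; first by rewrite /= fE he scale1r.
have sub : is_subspace [set t | pure_r Y e (f t) = t].
  split=> [|a u v uE vE]; first by rewrite /mkset !linear0.
  by rewrite /mkset !linearP uE vE.
apply: (tensor_ind sub) => x y; rewrite /mkset fE linearZ /=.
rewrite [in RHS](hE x); exact/esym/(linearZ_LR (pure_l X y)).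
Qed.

End Tensors.
(** * The thin representation on a connected set *)

Section Thin.
Variables (K : fieldType) (Q : quiver) (al : set Q).

Definition thin_dim (i : Q) : nat := `[< al i >].

(** Row vectors of length 1 on al and of length 0 elsewhere: the partial identity
    matrix is then the identity along the arrows in al and zero on all others,
    without any case distinction on dependent types. *)
Definition thin : representation K Q :=
  @Representation K Q (fun i => 'rV[K]_(thin_dim i)) (fun e => mulmxr (pid_mx 1)).

Definition thin_gen i : thin i := (const_mx 1 : 'rV[K]_(thin_dim i)).

Fact thin_coord_linear i : linear (fun x : 'rV[K]_(thin_dim i) => \sum_j x 0 j : K^o).
Proof.
by move=> a x y; rewrite scaler_sumr -big_split; apply: eq_bigr => j _; rewrite !mxE.
Qed.

(** The sum of the entries is the unique entry on al, and makes sense in length 0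
    as well. *)
Definition thin_coord i : {linear thin i -> K^o} :=
  HB.pack (fun x : 'rV[K]_(thin_dim i) => \sum_j x 0 j : K^o)
    (GRing.isLinear.Build K 'rV[K]_(thin_dim i) K^o *:%R _ (@thin_coord_linear i)).

Lemma thin_dim1 i : al i -> thin_dim i = 1%N.
Proof. by move=> ali; rewrite /thin_dim asboolT. Qed.

Lemma thin_outside i (x y : thin i) : ~ al i -> x = y.
Proof.
move=> nali; have d0 : thin_dim i = 0%N by rewrite /thin_dim asboolF.
by apply/matrixP => k j; have := ltn_ord j; lia.
Qed.

Lemma thin_coord_gen i : al i -> thin_coord i (thin_gen i) = 1.
Proof.
move=> /thin_dim1 d1; rewrite /= (eq_bigr (fun=> 1)) => [|j _]; last by rewrite mxE.
by rewrite sumr_const card_ord d1.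
Qed.

Lemma thin_coordE i (x : thin i) : x = thin_coord i x *: thin_gen i.
Proof.
case: (pselect (al i)) => [/thin_dim1 d1|/thin_outside]; last exact.
apply/rowP => j; rewrite !mxE mulr1 /= (bigD1 j) //= big1 ?addr0 // => k.
by rewrite -val_eqE /=; have := ltn_ord j; have := ltn_ord k; lia.
Qed.

Lemma thin_rmap e : arrow_in al e -> rmap thin e (thin_gen (src e)) = thin_gen (tgt e).
Proof.
move=> [als alt]; rewrite /= /thin_gen /thin_dim.
case: asboolP => // _; case: asboolP => // _.
by apply/rowP => j; rewrite !mxE big_ord1 !mxE !ord1 mulr1.
Qed.

Lemma thin_gen_split (A B : subrep thin) i : direct_sum A B ->
  (thin_gen i \in A i) || (thin_gen i \in B i).
Proof.
move=> AB; have [_ /(_ (thin_gen i))[y [z [Ay Bz yz]]]] := AB i.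
case: (eqVneq (thin_coord i y) 0) => [y0|yN0]; apply/orP; [right|left].
  by rewrite yz (thin_coordE y) y0 scale0r add0r.
have -> : thin_gen i = (thin_coord i y)^-1 *: y.
  by rewrite [X in _ *: X]thin_coordE scalerA mulVf // scale1r.
exact: rpredZ.
Qed.

Lemma thin_gen_neq0 i : al i -> thin_gen i != 0.
Proof.
move=> /thin_coord_gen; apply: contra_eqN => /eqP ->.
by rewrite linear0 eq_sym oner_eq0.
Qed.

(** The generator at each vertex of al lies in exactly one summand, and maps of
    the representation carry generators to generators; so along every arrow, in
    either direction, the summand does not change. *)
Lemma thin_summand (A B : subrep thin) c : connected_subquiver al -> al c ->
  direct_sum A B -> thin_gen c \in A c -> ~ nonzero_subrep B.
Proof.
move=> [_ cal] alc AB gc.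
have back e : arrow_in al e ->
    thin_gen (tgt e) \in A (tgt e) -> thin_gen (src e) \in A (src e).
  move=> ale gt; have /orP[//|gs] := thin_gen_split (src e) AB.
  have /subrep_stable := gs; rewrite thin_rmap // => gt'.
  have [/(_ _ gt gt') g0 _] := AB (tgt e).
  by have := thin_gen_neq0 ale.2; rewrite g0 eqxx.
have gA i : al i -> thin_gen i \in A i.
  move=> ali; have [p] := cal c i alc ali.
  elim: p {ali} => [//|e p IH|e p IH] /= pal.
    have gs : thin_gen (src e) \in A (src e).
      by apply: IH => v vp; apply: pal; rewrite /= mem_rcons inE vp orbT.
    rewrite -thin_rmap; first exact: subrep_stable.
    split; apply: pal; first by rewrite /= mem_rcons inE route_end orbT.
    by rewrite /= mem_rcons mem_head.
  apply: back; last first.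
    by apply: IH => v vp; apply: pal; rewrite /= mem_rcons inE vp orbT.
  split; apply: pal; first by rewrite /= mem_rcons mem_head.
  by rewrite /= mem_rcons inE route_end orbT.
move=> [i [x [Bx /eqP]]]; apply.
case: (pselect (al i)) => [ali|]; last exact: thin_outside.
have [AB0 _] := AB i; apply: AB0 => //.
by rewrite (thin_coordE x); apply: rpredZ; exact: gA.
Qed.

Lemma direct_sum_sym (V : representation K Q) (A B : subrep V) :
  direct_sum A B -> direct_sum B A.
Proof.
move=> AB i; have [AB0 ABD] := AB i; split=> [x Bx Ax|x]; first exact: AB0.
by have [y [z [Ay Bz ->]]] := ABD x; exists z, y; split=> //; rewrite addrC.
Qed.

Lemma thin_indecomposable : connected_subquiver al -> indecomposable thin.
Proof.
move=> cal; have [[c alc] _] := cal; split.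
  by exists c, (thin_gen c); exact: thin_gen_neq0.
move=> [A [B [_ A0 _ B0 AB]]].
have /orP[gA|gB] := thin_gen_split c AB; first exact: thin_summand gA B0.
exact: thin_summand (direct_sum_sym AB) gB A0.
Qed.

End Thin.
(** * Representations with invertible arrows on a connected set *)

Section LocallyConstant.
Variables (K : fieldType) (Q : quiver) (treeQ : is_tree Q).
Variables (al : set Q) (W : representation K Q).
Hypothesis al_conn : connected_subquiver al.
Hypothesis W_inj : forall e, arrow_in al e -> injective (rmap W e).
Hypothesis W_surj : forall e, arrow_in al e -> forall w, exists t, rmap W e t = w.

Lemma backward_exists e : exists g : {linear W (tgt e) -> W (src e)},
  arrow_in al e -> cancel (rmap W e) g /\ cancel g (rmap W e).
Proof.
case: (pselect (arrow_in al e)) => [ale|nale]; last by exists \0.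
by have [g fg gf] := linear_inverse (W_inj ale) (W_surj ale); exists g.
Qed.

Definition backward e := projT1 (cid (backward_exists e)).

Lemma backwardP e : arrow_in al e ->
  cancel (rmap W e) (backward e) /\ cancel (backward e) (rmap W e).
Proof. by rewrite /backward; case: cid => g /=. Qed.

(** Parallel transport along a route; on arrows outside al, [backward] is an
    arbitrary linear map. *)
Fixpoint parallel i j (p : route i j) : {linear W i -> W j} :=
  match p in route _ j return {linear W i -> W j} with
  | Rnil => idfun
  | Rfwd e q => rmap W e \o parallel q
  | Rbwd e q => backward e \o parallel q
  end.

Lemma parallel_inverse i j (p : route i j) : [set` rverts p] `<=` al ->
  exists2 g : {linear W j -> W i}, cancel (parallel p) g & cancel g (parallel p).
Proof.
elim: p => [|e p IH|e p IH] /= pal; first by exists idfun.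
  have ale : arrow_in al e.
    by split; apply: pal; rewrite /= mem_rcons inE ?route_end ?eqxx ?orbT.
  have [|g pg gp] := IH.
    by move=> v vp; apply: pal; rewrite /= mem_rcons inE vp orbT.
  have [fb bf] := backwardP ale.
  exists (g \o backward e); [exact: can_comp fb pg|exact: can_comp gp bf].
have ale : arrow_in al e.
  by split; apply: pal; rewrite /= mem_rcons inE ?route_end ?eqxx ?orbT.
have [|g pg gp] := IH.
  by move=> v vp; apply: pal; rewrite /= mem_rcons inE vp orbT.
have [fb bf] := backwardP ale.
exists (g \o rmap W e); [exact: can_comp bf pg|exact: can_comp gp fb].
Qed.

(** Of the two geodesics from c to the ends of e, one extends the other by e, so
    the identifications of the W i with W c are compatible with all arrows in
    al; in a graph with cycles monodromy would obstruct this. *)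
Lemma parallel_arrow c e y : arrow_in al e ->
  rmap W e (parallel (geo treeQ c (src e)) y) = parallel (geo treeQ c (tgt e)) y.
Proof.
move=> ale; case: (adjacent_btw treeQ c (adjacent_src e)) => /geo_cat ->.
  by rewrite geo_fwd.
by rewrite geo_bwd /= (backwardP ale).2.
Qed.

Hypothesis W_outside : forall i (w : W i), ~ al i -> w = 0.

Lemma trivialization_exists c i : al c ->
  exists2 phi : {linear W i -> tensor (thin K al i) (W c)}, bijective phi &
    al i -> forall y, phi (parallel (geo treeQ c i) y) = pure (thin_gen K al i) y.
Proof.
move=> alc; case: (pselect (al i)) => [ali|nali].
  have gal : [set` rverts (geo treeQ c i)] `<=` al.
    by move=> v; apply: linked_btw; case: al_conn.
  have [g pg gp] := parallel_inverse gal.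
  have pb := pure_line_bijective (W c) (thin_coord_gen K ali) (@thin_coordE K Q al i).
  exists (pure_r (W c) (thin_gen K al i) \o g) => [|_ y]; last by rewrite /= pg.
  by apply: bij_comp pb _; exists (parallel (geo treeQ c i)).
exists \0 => //; exists (fun=> 0) => [w|]; first by rewrite [w]W_outside.
have sub : is_subspace [set t : tensor (thin K al i) (W c) | 0 = t].
  by split=> [//|a u v <- <-]; rewrite /mkset scaler0 addr0.
apply: (tensor_ind sub) => x y.
rewrite (thin_outside x 0 nali).
exact/esym/(linear0 (pure_l (thin K al i) y)).
Qed.

(** The isomorphism at i sends a vector to generator tensor its parallel transport
    back to W c; outside al both sides are zero. *)
Lemma locally_constant_isotypic : isotypic W.
Proof.
have [[c alc] _] := al_conn.
pose phi i := sval (cid2 (trivialization_exists i alc)).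
have phi_bij i : bijective (phi i) by rewrite /phi; case: cid2.
have phiE i y : al i -> phi i (parallel (geo treeQ c i) y) = pure (thin_gen K al i) y.
  by rewrite /phi; case: cid2 => //= f _ fE /fE.
exists (thin K al), (W c), phi; split=> //; first exact: thin_indecomposable.
move=> e w.
case: (pselect (al (src e))) => [als|/(W_outside w) ->]; last by rewrite !linear0.
case: (pselect (al (tgt e))) => [alt|nalt].
  have geo_al : [set` rverts (geo treeQ c (src e))] `<=` al.
    by move=> v; apply: linked_btw; case: al_conn.
  have [g _ gK] := parallel_inverse geo_al.
  by rewrite -(gK w) parallel_arrow // !phiE // tensor_mapE thin_rmap.
have [g _ gK] := phi_bij (tgt e).
by rewrite -[RHS]gK [g _]W_outside // [rmap W e w]W_outside.
Qed.

End LocallyConstant.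
(** * The isotypic quotient *)

Theorem proposition5p4 (K : fieldType) (Q : quiver) (treeQ : is_tree Q)
  (branchedQ : finitely_branched Q) (outwardQ : eventually_outward Q)
  (V : representation K Q) (al : set Q) (al_conn : connected_subquiver al)
  (al_virtual : forall e : arrow Q, arrow_in al e ->
     exists E : walk Q,
       [/\ virtual_boundary_arrow [set: Q] E,
           virtual_behind e E
         & forall E' : walk Q, virtual_boundary_arrow [set: Q] E' ->
             virtual_behind e E' -> same_virtual_arrow E E']) :
  isotypic (Wrep treeQ V al).
Proof.
have one e : arrow_in al e -> one_end_behind e.
  move=> /al_virtual[E [[vE _] _ uE]]; exists E => // E' vE' bE'.
  apply: uE; first by split.
  by exists E' => //; exact: end_segment_refl.
apply: (locally_constant_isotypic treeQ al_conn) => [e ale|e ale w|i w nali].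
- exact: W_injective (one e ale).
- exact: W_surjective al_conn.2 ale (one e ale).
- exact: W_outside nali.
Qed.
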